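(* Let $\mu>-1$, $\nu>\frac12$ and $b>a>0$. Then the function $$x\mapsto \Omega_{\mu,\nu,a,b}(x)=\left(\frac{b}{a}\right)^{\mu-\nu}\frac{I_{\mu}(a\sqrt{x})\,I_{\nu}(b\sqrt{x})}{I_{\mu}(b\sqrt{x})\,I_{\nu}(a\sqrt{x})}\cdot e^{-b\sqrt{x}},\qquad x>0,$$ is the Laplace transform of an infinitely divisible distribution with support $[0,\infty)$.
   Context: $I_\mu$ is the modified Bessel function of the first kind of order $\mu$. The Laplace transform of a probability distribution $\lambda$ on $[0,\infty)$ is $x\mapsto\int_0^\infty e^{-xt}d\lambda(t)$. A probability distribution $\lambda$ on $[0,\infty)$ is infinitely divisible if for every $n\in\mathbb{N}$ there is a probability distribution $\lambda_n$ on $[0,\infty)$ with $\int_0^\infty e^{-xt}d\lambda(t)=\left[\int_0^\infty e^{-xt}d\lambda_n(t)\right]^n$ for all $x>0$. *)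

(* Defs.v *)
From HB Require Import structures.
From mathcomp Require Import all_boot all_order all_algebra.
From mathcomp Require Import all_classical all_reals all_analysis.

Set Implicit Arguments.
Unset Strict Implicit.
Unset Printing Implicit Defensive.

Import Order.TTheory GRing.Theory Num.Theory.
Import numFieldNormedType.Exports.

Local Open Scope classical_set_scope.
Local Open Scope ring_scope.

(* Euler's integral; it converges, hence is the Gamma function, only for
   s > 0 (elsewhere its value is not meaningful). *)
Definition Gamma (R : realType) (s : R) : R :=
  \int[lebesgue_measure]_(t in `]0, +oo[) (t `^ (s - 1) * expR (- t)).

(* I_mu(x) = sum_k (x/2)^(2k + mu) / (k! Gamma(k + mu + 1)), to be used for
   x > 0 and mu > -1, where every Gamma argument k + mu + 1 is positive. *)
Definition besselI (R : realType) (mu x : R) : R :=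
  limn (series (fun k : nat =>
    (x / 2) `^ (2 * k%:R + mu) / (k`!%:R * Gamma (k%:R + mu + 1)))).

Definition Omega (R : realType) (mu nu a b x : R) : R :=
  (b / a) `^ (mu - nu) *
  ((besselI mu (a * Num.sqrt x) * besselI nu (b * Num.sqrt x)) /
   (besselI mu (b * Num.sqrt x) * besselI nu (a * Num.sqrt x))) *
  expR (- (b * Num.sqrt x)).

(* A distribution on [0, +oo[ is represented as a Borel probability measure
   on the whole line that gives full mass to [0, +oo[. *)
Definition on_halfline (R : realType)
    (lam : probability (measurableTypeR R) R) : Prop :=
  lam (`[0, +oo[%classic : set R) = 1%E.

Definition laplace (R : realType)
    (lam : probability (measurableTypeR R) R) (x : R) : R :=
  \int[lam]_(t in `[0, +oo[) expR (- (x * t)).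

Definition infinitely_divisible (R : realType)
    (lam : probability (measurableTypeR R) R) : Prop :=
  on_halfline lam /\
  forall n : nat, (0 < n)%N ->
    exists2 lam_n : probability (measurableTypeR R) R,
      on_halfline lam_n &
      forall x : R, 0 < x -> laplace lam x = laplace lam_n x ^+ n.

(* Topological support: the points all of whose open neighbourhoods are
   charged. *)
Definition msupport (R : realType)
    (lam : probability (measurableTypeR R) R) : set R :=
  [set t : R | forall U : set R, open U -> U t -> (0 < lam U)%E].

(* Main.v *)
(* Up to a constant factor I_nu(t) is t^nu F(t^2), with the entire series
   F(x) = sum_k x^k / (4^k k! (s)_k) and s = nu + 1. By Bernstein's theorem
   everything reduces to the signs of iterated differences in x.

   (1) F(zx)/F(x) is completely monotone for 0 <= z <= 1: as a function of z it
   solves z v'' + s v' = (x/4) v with v(1) = 1, so its n-th difference in x solves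
   the same equation with a source whose sign is that of the (n-1)-st difference
   and vanishes at z = 1 for n > 0; a comparison (Wronskian) argument concludes by
   induction, and also shows that -ln (F(ax)/F(bx)) is a Bernstein function.

   (2) For order nu > 1/2, compare y(t) = t^(nu+1/2) F(t^2 x), which solves
   y'' = (x + (nu^2 - 1/4)/t^2) y, with exp(t sqrt x): the Wronskian identity
   expresses nu + 1/2 + 2xF'(x)/F(x) - sqrt x as an average over t of
   (F(t^2 x)/F(x)) exp(-(1-t) sqrt x), which is completely monotone by (1).
   Integrating in the scale, -ln of exp(-(b-a) sqrt x) F(b^2 x)/F(a^2 x) is a
   Bernstein function.

   Hence -ln Omega is a Bernstein function plus a sqrt x, and every power
   Omega^(1/n) is a Laplace transform. For the support, (1 + a^2 x/8)
   exp(-a sqrt x) is still completely monotone, so the law is a convolution with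
   an exponential law; the other factor charges every neighbourhood of 0 because
   ln Omega = O(sqrt x).

   Bernstein's theorem is obtained from Hausdorff's positive weights by passing to
   the limit along an ultrafilter, which gives a positive functional on bounded
   functions, and then a distribution function. *)

Require Import Defs.
From HB Require Import structures.
From mathcomp Require Import all_boot all_order all_algebra.
From mathcomp Require Import all_classical all_reals all_analysis.
From mathcomp Require Import measurable_realfun ring lra.

Set Implicit Arguments.
Unset Strict Implicit.
Unset Printing Implicit Defensive.

Import Order.TTheory GRing.Theory Num.Theory.
Import numFieldNormedType.Exports.

Local Open Scope classical_set_scope.
Local Open Scope ring_scope.

(** * Iterated differences *)

Section PointwiseDerivatives.
Variable R : realType.
Implicit Types (f g : R -> R) (x c df dg : R).

Lemma is_derive1D f g x df dg : is_derive x (1 : R) f df -> is_derive x (1 : R) g dg ->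
  is_derive x (1 : R) (fun y => f y + g y) (df + dg).
Proof. exact: is_deriveD. Qed.

Lemma is_derive1B f g x df dg : is_derive x (1 : R) f df -> is_derive x (1 : R) g dg ->
  is_derive x (1 : R) (fun y => f y - g y) (df - dg).
Proof. exact: is_deriveB. Qed.

Lemma is_derive1N f x df : is_derive x (1 : R) f df ->
  is_derive x (1 : R) (fun y => - f y) (- df).
Proof. exact: is_deriveN. Qed.

Lemma is_derive1M f g x df dg : is_derive x (1 : R) f df -> is_derive x (1 : R) g dg ->
  is_derive x (1 : R) (fun y => f y * g y) (df * g x + f x * dg).
Proof.
move=> f' g'; apply: (@is_derive_eq _ _ _ _ _ _ _ _ (is_deriveM f' g')).
by rewrite /GRing.scale /= addrC mulrC.
Qed.

Lemma is_derive1Z c f x df : is_derive x (1 : R) f df ->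
  is_derive x (1 : R) (fun y => c * f y) (c * df).
Proof. exact: is_deriveZ. Qed.

Lemma is_derive1_div f g x df dg : g x != 0 ->
  is_derive x (1 : R) f df -> is_derive x (1 : R) g dg ->
  is_derive x (1 : R) (fun y => f y / g y) ((df * g x - f x * dg) / g x ^+ 2).
Proof.
move=> gx f' g'.
apply: (@is_derive_eq _ _ _ _ _ _ _ _ (is_derive1M f' (is_deriveV gx g'))).
by rewrite /GRing.scale /=; field.
Qed.

Lemma is_derive1_compE f g x df dg : is_derive (g x) (1 : R) f df ->
  is_derive x (1 : R) g dg -> is_derive x (1 : R) (fun y => f (g y)) (df * dg).
Proof. exact: is_derive1_comp. Qed.

Lemma is_derive1_scale c f x df : is_derive (x * c) (1 : R) f df ->
  is_derive x (1 : R) (fun y => f (y * c)) (c * df).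
Proof.
move=> f'; rewrite mulrC; apply: is_derive1_compE => //.
apply: (@is_derive_eq _ _ _ _ _ _ _ _ (is_derive1M (is_derive_id x 1) (is_derive_cst c x 1))).
by rewrite mul1r mulr0 addr0.
Qed.

End PointwiseDerivatives.

(** * Completely monotone and Bernstein functions through differences *)

Section Differences.
Variable R : realType.
Implicit Types (f g : R -> R) (h x : R).

(** Minus the forward difference, so that complete monotonicity needs no factor (-1)^n. *)
Definition diff h f x := f x - f (x + h).

(** Differences replace derivatives: no smoothness is presupposed, and the condition passes to
    pointwise limits. *)
Definition cmono f :=
  forall n h x, 0 < h -> 0 < x -> 0 <= iter n (diff h) f x.

(* Nonnegativity, usually part of the definition, is not required. *)
Definition bernstein f :=
  forall n h x, 0 < h -> 0 < x -> iter n.+1 (diff h) f x <= 0.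

Lemma eq_iter_diff n h f g x : 0 < h -> (forall y, x <= y -> f y = g y) ->
  iter n (diff h) f x = iter n (diff h) g x.
Proof.
move=> h0; elim: n x => [|n IH] x fg /=; first exact: fg.
rewrite /diff IH // IH // => y xy; apply: fg.
by apply: le_trans xy; rewrite lerDl ltW.
Qed.

Lemma iter_diffD n h f g x :
  iter n (diff h) (fun y => f y + g y) x
  = iter n (diff h) f x + iter n (diff h) g x.
Proof. by elim: n x => [|n IH] x //=; rewrite /diff !IH; ring. Qed.

Lemma iter_diffZ n h f c x :
  iter n (diff h) (fun y => c * f y) x = c * iter n (diff h) f x.
Proof. by elim: n x => [|n IH] x //=; rewrite /diff !IH; ring. Qed.

Lemma iter_diffN n h f x :
  iter n (diff h) (fun y => - f y) x = - iter n (diff h) f x.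
Proof. by elim: n x => [|n IH] x //=; rewrite /diff !IH; ring. Qed.

Lemma iter_diff_cst n h c x : iter n.+1 (diff h) (fun=> c) x = 0.
Proof.
by elim: n x => [|n IH] x; [rewrite /= /diff subrr|rewrite iterS /diff !IH subrr].
Qed.

Lemma iter_diff_shift n h f c x :
  iter n (diff h) (fun y => f (y + c)) x = iter n (diff h) f (x + c).
Proof. by elim: n x => [|n IH] x //=; rewrite /diff !IH [x + h + c]addrAC. Qed.

Lemma iter_diff_scale n h f c x :
  iter n (diff h) (fun y => f (c * y)) x = iter n (diff (c * h)) f (c * x).
Proof. by elim: n x => [|n IH] x //=; rewrite /diff !IH mulrDr. Qed.

(** Leibniz rule for the factor [y], whose second difference vanishes. The term with the lower
    difference becomes the source in the induction for Bessel quotients. *)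
Lemma iter_diffX n h f x :
  iter n (diff h) (fun y => y * f y) x =
  x * iter n (diff h) f x - n%:R * h * iter n.-1 (diff h) f (x + h).
Proof.
elim: n x => [|n IH] x /=; first by rewrite !mul0r subr0.
rewrite /diff !IH.
case: n {IH} => [|n] /=; first by rewrite /diff; ring.
rewrite /diff -[n.+2%:R]natr1 -[n.+1%:R]natr1; ring.
Qed.

Lemma iter_diff_cvg (T : Type) (F : set_system T) {FF : Filter F} n h
    (g : T -> R -> R) f x : 0 < h ->
  (forall y, x <= y -> g t y @[t --> F] --> f y) ->
  iter n (diff h) (g t) x @[t --> F] --> iter n (diff h) f x.
Proof.
move=> h0; elim: n x => [|n IH] x gf /=; first exact: gf.
apply: cvgB; apply: IH => // y xy; apply: gf.
by apply: le_trans xy; rewrite lerDl ltW.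
Qed.

Lemma is_derive_iter_diff n h (g : R -> R -> R) (g' : R -> R) x (t : R) : 0 < h ->
  (forall y, x <= y -> is_derive t (1 : R) (fun s => g s y) (g' y)) ->
  is_derive t (1 : R) (fun s => iter n (diff h) (g s) x) (iter n (diff h) g' x).
Proof.
move=> h0; elim: n x => [|n IH] x gg' /=; first exact: gg'.
rewrite /diff; apply: is_deriveB; apply: IH => // y xy; apply: gg'.
by apply: le_trans xy; rewrite lerDl ltW.
Qed.

(** The identity is the sum of two commuting operators, [diff h] and the shift by [h]; this is the
    binomial expansion of its n-th power. *)
Lemma newton_diff n h f x :
  f x = \sum_(i < n.+1) 'C(n, i)%:R * iter (n - i) (diff h) f (x + i%:R * h).
Proof.
elim: n f x => [|n IH] f x.
  by rewrite big_ord_recl big_ord0 /= bin0 mul0r !addr0 mul1r.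
have -> : f x = diff h f x + f (x + h) by rewrite /diff subrK.
rewrite (IH (diff h f)) (IH f (x + h)).
rewrite [RHS]big_ord_recl [X in X + _]big_ord_recl /= !bin0 subn0 !mul1r mul0r addr0.
rewrite -iterSr /= -addrA; congr (_ + _).
rewrite [X in _ + X]big_ord_recr [RHS]big_ord_recr /= !binn !subnn !mul1r addrA.
congr (_ + _); last first.
  rewrite /bump /= add1n -[in RHS]natr1.
  by congr (f _); ring.
rewrite -big_split /=; apply: eq_bigr => i _.
rewrite /bump /= add1n subSS binS natrD mulrDl addrC.
have -> : x + h + i%:R * h = x + i.+1%:R * h by rewrite -natr1; ring.
by rewrite -iterSr -subSn // subSS [LHS]addrC.
Qed.

(** Complete monotonicity confined to the grid x, ..., x + n h: the constraint on [k + i] keeps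
    every evaluation point on it. This finite version applies to [f X - f] for a Bernstein [f] and
    the last grid point [X]. *)
Definition alternating n h x f :=
  forall k i, (k + i <= n)%N -> 0 <= iter k (diff h) f (x + i%:R * h).

Lemma alternatingS n h x f : alternating n.+1 h x f ->
  [/\ alternating n h x f, alternating n h x (diff h f) &
      alternating n h x (fun y => f (y + h))].
Proof.
move=> af; split=> k i kin.
- by apply: af; rewrite (leq_trans kin).
- by rewrite -iterSr; apply: af.
- rewrite iter_diff_shift -addrA.
  have -> : i%:R * h + h = i.+1%:R * h by rewrite -natr1; ring.
  by apply: af; rewrite addnS.
Qed.

(** Induction on [n] through the product rule D(fg) = (Df) g + f(. + h) (Dg), whose four factors are
    alternating of order one less. *)
Lemma alternatingM n h x f g : alternating n h x f -> alternating n h x g ->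
  alternating n h x (fun y => f y * g y).
Proof.
elim: n f g => [|n IH] f g af ag k i.
  by rewrite leqn0 addn_eq0 => /andP[/eqP -> /eqP ->]; apply: mulr_ge0;
    [apply: (af 0 0) | apply: (ag 0 0)].
case: k => [|k]; first by move=> kin; apply: mulr_ge0; [apply: (af 0) | apply: (ag 0)].
rewrite addSn ltnS => kin.
have [af0 afD afS] := alternatingS af.
have [ag0 agD agS] := alternatingS ag.
have -> : iter k.+1 (diff h) (fun y => f y * g y) =
    iter k (diff h) (fun y => diff h f y * g y + f (y + h) * diff h g y).
  rewrite iterSr; congr iter; apply/funext => y; rewrite /diff; ring.
by rewrite iter_diffD addr_ge0 //; apply: IH.
Qed.

Lemma cmono_alternating n h x f : 0 < h -> 0 < x -> cmono f -> alternating n h x f.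
Proof.
by move=> h0 x0 cf k i _; apply: cf => //; rewrite ltr_wpDr // mulr_ge0 // ltW.
Qed.

Lemma cmono_ge0 f x : 0 < x -> cmono f -> 0 <= f x.
Proof. by move=> x0 /(_ 0%N 1 x ltr01 x0). Qed.

Lemma cmonoM f g : cmono f -> cmono g -> cmono (fun y => f y * g y).
Proof.
move=> cf cg n h x h0 x0.
have /(_ n 0%N) := alternatingM (cmono_alternating (n := n) h0 x0 cf)
  (cmono_alternating (n := n) h0 x0 cg).
by rewrite addn0 mul0r addr0; apply.
Qed.

Lemma cmono_ext f g : (forall x, 0 < x -> f x = g x) -> cmono f -> cmono g.
Proof.
move=> fg cf n h x h0 x0; rewrite -(@eq_iter_diff _ _ f) ?cf // => y xy.
by apply: fg; apply: lt_le_trans xy.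
Qed.

Lemma bernstein_ext f g : (forall x, 0 < x -> f x = g x) -> bernstein f -> bernstein g.
Proof.
move=> fg cf n h x h0 x0; rewrite -(@eq_iter_diff _ _ f) ?cf // => y xy.
by apply: fg; apply: lt_le_trans xy.
Qed.

Lemma bernstein_cstB c f : cmono f -> bernstein (fun x => c - f x).
Proof.
move=> cf n h x h0 x0.
by rewrite iter_diffD iter_diff_cst iter_diffN add0r oppr_le0; exact: cf.
Qed.

Lemma bernsteinD f g : bernstein f -> bernstein g -> bernstein (fun x => f x + g x).
Proof.
by move=> bf bg n h x h0 x0; rewrite iter_diffD -oppr_ge0 opprD addr_ge0 ?oppr_ge0 ?bf ?bg.
Qed.

Lemma bernsteinZ c f : 0 <= c -> bernstein f -> bernstein (fun x => c * f x).
Proof. by move=> c0 bf n h x h0 x0; rewrite iter_diffZ mulr_ge0_le0 ?bf. Qed.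

Lemma bernstein_scale c f : 0 < c -> bernstein f -> bernstein (fun x => f (c * x)).
Proof. by move=> c0 bf n h x h0 x0; rewrite iter_diff_scale; apply: bf; rewrite mulr_gt0. Qed.

Lemma is_derive_le (a b : R) (u u' : R -> R) : a <= b ->
  (forall t, a <= t <= b -> is_derive t (1 : R) u (u' t)) ->
  (forall t, a <= t <= b -> 0 <= u' t) -> u a <= u b.
Proof.
move=> ab du u'0.
have [t||c] := @MVT_segment _ u u' a b ab.
- by rewrite in_itv /= => /andP[/ltW ta /ltW tb]; apply: du; rewrite ta tb.
- apply: derivable_within_continuous => t; rewrite in_itv /= => tab.
  by have [] := du t tab.
by rewrite in_itv /= => cab E; rewrite -subr_ge0 E mulr_ge0 ?u'0 // subr_ge0.
Qed.

(* The differences in [x] commute with the derivative in [t]. *)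
Lemma bernstein_increment (a b : R) (g g' : R -> R -> R) : a <= b ->
  (forall t x, a <= t <= b -> 0 < x -> is_derive t (1 : R) (g^~ x) (g' t x)) ->
  (forall t, a <= t <= b -> bernstein (g' t)) ->
  bernstein (fun x => g b x - g a x).
Proof.
move=> ab dg bg' n h x h0 x0.
rewrite iter_diffD iter_diffN subr_le0 -lerN2.
pose u t := - iter n.+1 (diff h) (g t) x.
apply: (@is_derive_le a b u (fun t => - iter n.+1 (diff h) (g' t) x)) => // t tab.
  apply: is_deriveN; apply: is_derive_iter_diff => // y xy.
  by apply: dg => //; apply: lt_le_trans xy.
by rewrite oppr_ge0 bg'.
Qed.

Lemma bernstein_nondecreasing f x y : bernstein f -> 0 < x -> x <= y -> f x <= f y.
Proof.
move=> bf x0; rewrite le_eqVlt => /orP[/eqP -> //|xy].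
by have := bf 0%N (y - x) x; rewrite /= /diff subr_gt0 subrKC subr_le0; exact.
Qed.

(* On the grid x, x + h, ..., x + nh the function is a constant minus a
   completely monotone function. *)
Lemma cmono_expRN f : bernstein f -> cmono (fun x => expR (- f x)).
Proof.
move=> bf n h x h0 x0.
pose X := x + n%:R * h.
pose g y := f X - f y.
have ag : alternating n h x g.
  move=> [|k] i kin.
    rewrite /= subr_ge0; apply: bernstein_nondecreasing => //.
      by rewrite ltr_wpDr // mulr_ge0 // ltW.
    by rewrite lerD2l ler_pM2r // ler_nat.
  rewrite iter_diffD iter_diff_cst iter_diffN add0r oppr_ge0; apply: bf => //.
  by rewrite ltr_wpDr // mulr_ge0 // ltW.
have agk k : alternating n h x (fun y => g y ^+ k).
  elim: k => [|k IH].
    move=> [|j] i _; first by rewrite /= expr0.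
    by rewrite (_ : (fun y => _) = fun=> 1) ?iter_diff_cst //; apply/funext => y.
  rewrite (_ : (fun y => _) = fun y => g y * g y ^+ k); first exact: alternatingM.
  by apply/funext => y; rewrite exprS.
have -> : (fun y => expR (- f y)) = (fun y => expR (- f X) * expR (g y)).
  by apply/funext => y; rewrite -expRD; congr expR; rewrite /g; ring.
rewrite iter_diffZ mulr_ge0 ?expR_ge0 //.
(* The exponential series has nonnegative coefficients and the powers of [g] are alternating, so the
   partial sums have nonnegative differences; these pass to the limit. *)
have cg : iter n (diff h) (fun y => series (exp_coeff (g y)) m) x @[m --> \oo]
   --> iter n (diff h) (fun y => expR (g y)) x.
  by apply: iter_diff_cvg => // y _; exact: is_cvg_series_exp_coeff.
apply: (cvgr_to_ge cg); apply: nearW => m /=.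
elim: m => [|m IH].
  rewrite (_ : (fun y => _) = fun=> 0); last by apply/funext => y; rewrite /series /= big_geq.
  by case: n {X g ag agk cg} => [|n] //; rewrite iter_diff_cst.
rewrite (_ : (fun y => _) = fun y => series (exp_coeff (g y)) m + m`!%:R^-1 * g y ^+ m); last first.
  by apply/funext => y; rewrite /series /= big_nat_recr //= /exp_coeff /= [in RHS]mulrC.
rewrite iter_diffD iter_diffZ addr_ge0 // mulr_ge0 ?invr_ge0 //.
by have := agk m n 0%N; rewrite addn0 mul0r addr0; exact.
Qed.

Lemma is_derive_iter_diff_shift n h f (f' : R -> R) x (t : R) : 0 < h -> 0 < x -> 0 <= t ->
  (forall y : R, 0 < y -> is_derive y (1 : R) f (f' y)) ->
  is_derive t (1 : R) (fun s => iter n (diff h) f (x + s)) (iter n (diff h) f' (x + t)).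
Proof.
move=> h0 x0 t0 df; have -> : (fun s => iter n (diff h) f (x + s)) =
    (fun s => iter n (diff h) (fun y => f (y + s)) x).
  by apply/funext => s; rewrite iter_diff_shift.
rewrite -iter_diff_shift; apply: is_derive_iter_diff => // y xy.
have y0 : 0 < shift y t by rewrite /= addrC ltr_wpDr // (lt_le_trans x0).
have -> : (fun s => f (y + s)) = f \o shift y.
  by apply/funext => s; rewrite /= addrC.
have := is_derive1_comp (df _ y0) (is_derive_shift t (1 : R) y).
by rewrite mulr1 /= addrC.
Qed.

(** The n-th difference of [f] is nondecreasing, since its derivative is the n-th difference of
    [f']. *)
Lemma bernstein_derive f (f' : R -> R) :
  (forall x, 0 < x -> is_derive x (1 : R) f (f' x)) -> cmono f' -> bernstein f.
Proof.
move=> df cf' n h x h0 x0; rewrite iterS /diff subr_le0 -[X in _ _ _ X <= _]addr0.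
apply: (@is_derive_le 0 h (fun t => iter n (diff h) f (x + t))); first exact: ltW.
  by move=> t /andP[t0 _]; exact: is_derive_iter_diff_shift.
by move=> t /andP[t0 _]; apply: cf' => //; rewrite ltr_wpDr.
Qed.

(** The sequence consists of the successive derivatives of [f 0] with alternating signs. One
    difference of [f k] is traded for one derivative, that is, for [f k.+1]. *)
Lemma cmono_derive (f : nat -> R -> R) :
  (forall k x, 0 < x -> 0 <= f k x) ->
  (forall k x, 0 < x -> is_derive x (1 : R) (f k) (- f k.+1 x)) ->
  cmono (f 0%N).
Proof.
move=> f0 df n; move: 0%N => k.
elim: n k => [|n IH] k h x h0 x0; first exact: f0.
rewrite /= /diff subr_ge0 -lerN2 -[X in _ _ _ X]addr0.
apply: (@is_derive_le 0 h (fun t => - iter n (diff h) (f k) (x + t))); first exact: ltW.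
  move=> t /andP[t0 _]; apply: is_derive1N.
  exact: (is_derive_iter_diff_shift n h0 x0 t0 (df k)).
move=> t /andP[t0 _]; rewrite iter_diffN opprK; apply: IH => //.
by rewrite ltr_wpDr.
Qed.

End Differences.

(** * Limits of bounded sequences along an ultrafilter *)

Section UltraLimit.
Variables (R : realType) (U : set_system nat).
Hypotheses (UU : UltraFilter U) (oU : \oo `<=` U).
Implicit Types (u v : nat -> R).

Definition bounded_seq u := exists M, forall n, `|u n| <= M.

(** Every bounded sequence has such a limit, linear and monotone in the sequence; this replaces the
    extraction of subsequences. *)
Definition ulim u : R := lim (u n @[n --> U]).

Lemma ultra_fmap (T : Type) (g : nat -> T) : UltraFilter (g n @[n --> U]).
Proof.
split; first exact: fmap_proper_filter.
move=> G GF sub; apply/predeqP => A; split; last exact: sub.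
move=> GA; have [//|nA] := in_ultra_setVsetC (g @^-1` A) UU.
have : G (A `&` ~` A) by apply: filterI => //; exact: sub.
by rewrite setICr => /filter_not_empty.
Qed.

(** The image of an ultrafilter is an ultrafilter; here it contains a compact interval, where every
    ultrafilter converges. *)
Lemma ulim_cvg u : bounded_seq u -> u n @[n --> U] --> ulim u.
Proof.
move=> [M uM]; have cM : compact `[- M, M]%classic by exact: segment_compact.
rewrite compact_ultra in cM.
have [|l [_ ul]] := cM _ (ultra_fmap u).
  by rewrite /fmap /=; apply: filterE => n /=; rewrite in_itv /= -ler_norml.
by apply: cvgP ul.
Qed.

Lemma cvgn_ulim u l : u n @[n --> \oo] --> l -> ulim u = l.
Proof.
move=> ul; apply: cvg_lim => //.
by apply: cvg_trans ul; apply: cvg_app.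
Qed.

Lemma ulimD c u v : bounded_seq u -> bounded_seq v ->
  ulim (fun n => c * u n + v n) = c * ulim u + ulim v.
Proof.
move=> bu bv; apply: cvg_lim => //.
by apply: cvgD; [apply: cvgM; [exact: cvg_cst|exact: ulim_cvg]|exact: ulim_cvg].
Qed.

Lemma ulim_le u v : bounded_seq u -> bounded_seq v -> (forall n, u n <= v n) ->
  ulim u <= ulim v.
Proof.
move=> bu bv uv; apply: (ler_cvg_to (ulim_cvg bu) (ulim_cvg bv)).
exact: nearW.
Qed.

Lemma ulim_norm_le u M : (forall n, `|u n| <= M) -> `|ulim u| <= M.
Proof.
move=> uM; have bu : bounded_seq u by exists M.
rewrite ler_norml; apply/andP; split.
  by apply: (cvgr_to_ge (ulim_cvg bu)); apply: nearW => n; have := uM n; rewrite ler_norml => /andP[].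
by apply: (cvgr_to_le (ulim_cvg bu)); apply: nearW => n; have := uM n; rewrite ler_norml => /andP[].
Qed.

End UltraLimit.

(** * Falling factorials against powers *)

Section FallingMoments.
Variable R : realType.

(** Both sides count the [(i + j)]-subsets of [n] elements together with an ordered choice of [j]
    elements of the subset. *)
Lemma bin_ffactD n i j : ('C(n, i + j) * (i + j) ^_ j = n ^_ j * 'C(n - j, i))%N.
Proof.
elim: j n => [|j IH] n; first by rewrite addn0 !ffactn0 subn0 muln1 mul1n.
rewrite addnS ffactSS ffactnS mulnCA mulnA -mul_bin_diag -mulnA IH mulnA.
by rewrite -subn1 -subnDA add1n.
Qed.

(** The ratio is a product of factors [(k - i) / (n - i)], each in [0, 1] and within [m / n] of
    [k / n]; the errors of the [j] factors add up. *)
Lemma ffact_ratio_dist m j k n : (j <= m)%N -> (m < n)%N -> (k <= n)%N ->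
  `|(k ^_ j)%:R / (n ^_ j)%:R - (k%:R / n%:R) ^+ j| <= j%:R * (m%:R / n%:R) :> R.
Proof.
move=> + mn kn; have n0 : 0 < n%:R :> R by rewrite ltr0n (leq_ltn_trans _ mn).
elim: j => [|j IH] jm.
  by rewrite !ffactn0 divr1 expr0 subrr normr0 mul0r.
have jn : (j < n)%N by rewrite (leq_trans jm) // ltnW.
have nj0 : 0 < n%:R - j%:R :> R by rewrite subr_gt0 ltr_nat.
rewrite !ffactnSr !natrM invfM mulrACA exprSr.
rewrite [(n - j)%:R]natrB ?(ltnW jn) //.
set a := _ / (n ^_ j)%:R; set b := k%:R / n%:R; set c := (k - j)%:R / _.
have b0 : 0 <= b by rewrite divr_ge0.
have b1 : b <= 1 by rewrite ler_pdivrMr // mul1r ler_nat.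
have c0 : 0 <= c by rewrite divr_ge0 // ltW.
have c1 : c <= 1.
  by rewrite ler_pdivrMr // mul1r -natrB ?(ltnW jn) // ler_nat leq_sub2r.
have jm' : j%:R <= m%:R :> R by rewrite ler_nat ltnW.
have bc : `|c - b| <= m%:R / n%:R.
  (* The subtraction [k - j] is truncated: for [k < j] the factor [c] is 0 and [b] itself is at most
     [m / n]. *)
  have [jk|kj] := leqP j k; last first.
    rewrite /c (eqP (_ : k - j == 0)%N) ?subn_eq0 ?(ltnW kj) // mul0r sub0r normrN ger0_norm //.
    by rewrite ler_pM2r ?invr_gt0 // ler_nat (leq_trans (ltnW kj)) // ltnW.
  have kn' : k%:R <= n%:R :> R by rewrite ler_nat.
  have jk' : j%:R <= k%:R :> R by rewrite ler_nat.
  have E : b - c = j%:R / n%:R * ((n%:R - k%:R) / (n%:R - j%:R)).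
    by rewrite /b /c natrB //; field; rewrite !gt_eqF.
  rewrite distrC E ger0_norm; last by rewrite mulr_ge0 ?divr_ge0 ?(ltW nj0) // subr_ge0.
  rewrite -[leRHS]mulr1 ler_pM ?divr_ge0 ?(ltW nj0) //.
  - by rewrite subr_ge0.
  - by rewrite ler_pM2r ?invr_gt0.
  by rewrite ler_pdivrMr // mul1r lerD2l lerN2.
have {IH} := IH (ltnW jm); rewrite -/a -/b; clearbody a b c => IH.
have -> : a * c - b ^+ j * b = (a - b ^+ j) * c + b ^+ j * (c - b) by ring.
rewrite -natr1 [leRHS]mulrDl mul1r (le_trans (ler_normD _ _)) // !normrM lerD //.
  rewrite (ger0_norm c0) -[leRHS]mulr1 ler_pM //.
rewrite normrX (ger0_norm b0) -[leRHS]mul1r ler_pM ?exprn_ge0 //.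
by rewrite exprn_ile1.
Qed.

End FallingMoments.

(** * Bernstein's theorem *)

Section HausdorffFunctional.
Variables (R : realType) (f : R -> R).
Hypotheses (cf : cmono f) (f_le1 : forall x, 0 < x -> f x <= 1).
Implicit Types (phi psi : R -> R).

Definition bounded_pos phi := exists M : R, forall t, 0 <= t -> `|phi t| <= M.

(** Plays the role of integration against a subprobability on [0, +oo[, possibly only finitely
    additive, for all bounded functions, measurable or not. *)
Definition pos_functional (L : (R -> R) -> R) :=
  [/\ forall c phi psi, bounded_pos phi -> bounded_pos psi ->
        L (fun t => c * phi t + psi t) = c * L phi + L psi,
      forall phi psi, bounded_pos phi -> bounded_pos psi ->
        (forall t, 0 <= t -> phi t <= psi t) -> L phi <= L psi &
      L (fun=> 1) <= 1].

(** Hausdorff's weight at the point [k / n] of [0, 1] for the moment sequence f(h), f(2h), ...; the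
    moments start at [h] because [f] is controlled only on ]0, +oo[. *)
Definition hausdorff_weight h n k : R :=
  'C(n, k)%:R * iter (n - k) (diff h) f (k.+1%:R * h).

Lemma hausdorff_weight_ge0 h n k : 0 < h -> 0 <= hausdorff_weight h n k.
Proof. by move=> h0; rewrite mulr_ge0 // cf // mulr_gt0. Qed.

(** Newton's expansion of order [n - j] at [(j + 1) h]: [bin_ffactD] turns its binomial coefficients
    into the weights, and the terms [k < j] vanish. *)
Lemma hausdorff_moment h n j : 0 < h -> (j <= n)%N ->
  \sum_(k < n.+1) hausdorff_weight h n k * ((k ^_ j)%:R / (n ^_ j)%:R) = f (j.+1%:R * h).
Proof.
move=> h0 jn; rewrite (newton_diff (n - j) h f (j.+1%:R * h)).
rewrite -(big_mkord xpredT (fun k => hausdorff_weight h n k * ((k ^_ j)%:R / (n ^_ j)%:R))).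
rewrite (@big_cat_nat _ _ _ j) //=; last by rewrite leqW.
rewrite big_nat big1 ?add0r; last first.
  by move=> k /andP[_ kj]; rewrite ffact_small // mul0r mulr0.
rewrite -{1}[j]add0n big_addn subSn // big_mkord; apply: eq_bigr => i _.
rewrite /hausdorff_weight subnDA subnAC.
have n0 : (n ^_ j)%:R != 0 :> R by rewrite pnatr_eq0 -lt0n ffact_gt0.
have -> : (i + j).+1%:R * h = j.+1%:R * h + i%:R * h by rewrite -addnS addnC natrD mulrDl.
rewrite mulrAC mulrA -natrM bin_ffactD natrM; congr (_ * _).
by rewrite mulrAC divff // mul1r.
Qed.

Lemma sum_hausdorff_weight h n : 0 < h -> \sum_(k < n.+1) hausdorff_weight h n k = f h.
Proof.
move=> h0; rewrite -[in RHS](mul1r h) -(hausdorff_moment h0 (leq0n n)).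
by apply: eq_bigr => k _; rewrite !ffactn0 divr1 mulr1.
Qed.

(** The exact moments use falling factorials; replacing them by powers costs at most [j * j / n]
    times the total mass [f h], which is at most 1. *)
Lemma cvg_hausdorff_moment h j : 0 < h ->
  \sum_(k < n.+1) hausdorff_weight h n k * (k%:R / n%:R) ^+ j @[n --> \oo] --> f (j.+1%:R * h).
Proof.
move=> h0; apply/cvgrPdist_le => e e0; near=> n.
have jn : (j < n)%N by near: n; exists j.+1.
rewrite -(hausdorff_moment h0 (ltnW jn)) -sumrB.
apply: (@le_trans _ _ (\sum_(k < n.+1) hausdorff_weight h n k * (j%:R * (j%:R / n%:R)))).
  rewrite (le_trans (ler_norm_sum _ _ _)) //; apply: ler_sum => k _.
  rewrite -mulrBr normrM ger0_norm ?hausdorff_weight_ge0 // ler_wpM2l ?hausdorff_weight_ge0 //.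
  by rewrite ffact_ratio_dist // -ltnS ltn_ord.
rewrite -mulr_suml sum_hausdorff_weight // -[leRHS]mul1r.
apply: ler_pM; [exact: cmono_ge0|by rewrite !mulr_ge0 ?invr_ge0|exact: f_le1|].
have n0 : 0 < n%:R :> R by rewrite ltr0n (leq_ltn_trans _ jn).
rewrite mulrA ler_pdivrMr // [leRHS]mulrC -ler_pdivrMr //.
near: n; exact: nbhs_infty_ger.
Unshelve. all: end_near. Qed.

(** The point [t] at which [expR (- t / N.+1)] equals [(k + 1) / n]: powers on [0, 1] become
    exponentials on the half-line. *)
Definition hausdorff_node N n k : R := - (N.+1%:R * ln (k.+1%:R / n%:R)).

Lemma hausdorff_node_ge0 N n k : (k < n)%N -> 0 <= hausdorff_node N n k.
Proof.
move=> kn; rewrite oppr_ge0 mulr_ge0_le0 // ln_le0 //.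
by rewrite ler_pdivrMr ?ltr0n ?(leq_ltn_trans _ kn) // mul1r ler_nat.
Qed.

(* The term [k = 0], sitting at [t = +oo], is left out. *)
Definition hausdorff_sum N n phi :=
  \sum_(k < n) hausdorff_weight N.+1%:R^-1 n k.+1 * phi (hausdorff_node N n k).

Lemma hausdorff_sum_norm_le N n phi M : (forall t, 0 <= t -> `|phi t| <= M) ->
  `|hausdorff_sum N n phi| <= M.
Proof.
move=> phiM; have M0 : 0 <= M by rewrite (le_trans _ (phiM 0 _)).
have h0 : 0 < N.+1%:R^-1 :> R by rewrite invr_gt0.
apply: (@le_trans _ _ (\sum_(k < n) hausdorff_weight N.+1%:R^-1 n k.+1 * M)).
  rewrite (le_trans (ler_norm_sum _ _ _)) //; apply: ler_sum => k _.
  rewrite normrM ger0_norm ?hausdorff_weight_ge0 // ler_wpM2l ?hausdorff_weight_ge0 //.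
  by rewrite phiM // hausdorff_node_ge0.
rewrite -mulr_suml -[leRHS]mul1r ler_wpM2r //.
apply: le_trans (f_le1 h0); rewrite -(sum_hausdorff_weight n h0) big_ord_recl lerDr.
exact: hausdorff_weight_ge0.
Qed.

Variables (U : set_system nat) (UU : UltraFilter U) (oU : \oo `<=` U).

(** The inner limit solves the moment problem for the samples of [f] at multiples of [1 / (N + 1)];
    the outer limit refines the mesh. *)
Definition hausdorff_functional phi : R :=
  ulim U (fun N => ulim U (fun n => hausdorff_sum N n phi)).

Lemma bounded_hausdorff_sum N phi : bounded_pos phi ->
  bounded_seq (fun n => hausdorff_sum N n phi).
Proof. by move=> [M phiM]; exists M => n; exact: hausdorff_sum_norm_le. Qed.

Lemma bounded_ulim_hausdorff_sum phi : bounded_pos phi ->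
  bounded_seq (fun N => ulim U (fun n => hausdorff_sum N n phi)).
Proof.
move=> [M phiM]; exists M => N; apply: (ulim_norm_le UU) => n.
exact: hausdorff_sum_norm_le.
Qed.

Lemma pos_hausdorff_functional : pos_functional hausdorff_functional.
Proof.
rewrite /hausdorff_functional; split => [c phi psi bphi bpsi|phi psi bphi bpsi le|].
- have B N := bounded_hausdorff_sum N; have B' := bounded_ulim_hausdorff_sum.
  rewrite -(ulimD UU c (B' _ bphi) (B' _ bpsi)).
  congr (ulim U _); apply/funext => N; rewrite -(ulimD UU c (B N _ bphi) (B N _ bpsi)).
  congr (ulim U _); apply/funext => n; rewrite /hausdorff_sum mulr_sumr -big_split /=.
  by apply: eq_bigr => k _; ring.
- apply: (ulim_le UU); [exact: bounded_ulim_hausdorff_sum..|move=> N].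
  apply: (ulim_le UU); [exact: bounded_hausdorff_sum..|move=> n].
  apply: ler_sum => k _; rewrite ler_wpM2l ?hausdorff_weight_ge0 ?invr_gt0 //.
  by rewrite le // hausdorff_node_ge0.
- apply: le_trans (ler_norm _) _; apply: (ulim_norm_le UU) => N.
  by apply: (ulim_norm_le UU) => n; apply: hausdorff_sum_norm_le => t _; rewrite normr1.
Qed.

Lemma bounded_expRN x : 0 < x -> bounded_pos (fun t => expR (- (x * t))).
Proof.
move=> x0; exists 1 => t t0.
by rewrite ger0_norm ?expR_ge0 // -expR0 ler_expR oppr_le0 mulr_ge0 // ltW.
Qed.

Lemma ulim_hausdorff_pow N j : (0 < j)%N ->
  ulim U (fun n => \sum_(k < n) hausdorff_weight N.+1%:R^-1 n k.+1 * (k.+1%:R / n%:R) ^+ j)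
  = f (j.+1%:R / N.+1%:R).
Proof.
move=> j0; have h0 : 0 < N.+1%:R^-1 :> R by rewrite invr_gt0.
apply: (cvgn_ulim UU oU); have := @cvg_hausdorff_moment _ j h0.
rewrite (_ : (fun n => \sum_(k < n.+1) _) = fun n => \sum_(k < n)
   hausdorff_weight N.+1%:R^-1 n k.+1 * (k.+1%:R / n%:R) ^+ j) //.
(* The omitted node [k = 0] contributes a multiple of [0 ^ j], which vanishes for [j > 0]. *)
apply/funext => n; rewrite big_ord_recl mul0r expr0n gtn_eqF // mulr0 add0r.
exact: eq_bigr.
Qed.

(* With [j = floor(x (N + 1))], the power [v^(x (N + 1))] lies between
   [v^(j + 1)] and [v^j] for [v] in [0, 1]. *)
Lemma ulim_hausdorff_exp N x : 0 < x ->
  f (x + 2 / N.+1%:R) <= ulim U (fun n => hausdorff_sum N n (fun t => expR (- (x * t)))) <= f x.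
Proof.
move=> x0; have N0 : 0 < N.+1%:R :> R by [].
have h0 : 0 < N.+1%:R^-1 :> R by rewrite invr_gt0.
have f_ni y z : 0 < y -> y <= z -> f z <= f y.
  move=> y0; rewrite le_eqVlt => /orP[/eqP -> //|yz].
  by have := cf 1%N (_ : 0 < z - y) y0; rewrite /= /diff subrKC subr_ge0 subr_gt0; apply.
pose y := x * N.+1%:R; have y0 : 0 < y by rewrite mulr_gt0.
pose j := Num.truncn y.
have [jy yj] : j%:R <= y /\ y < j.+1%:R.
  by have /andP[] := truncn_itv (ltW y0).
have node n k : (k < n)%N -> expR (- (x * hausdorff_node N n k)) = (k.+1%:R / n%:R) `^ y.
  move=> kn; rewrite /powR gt_eqF ?divr_gt0 ?ltr0n ?(leq_ltn_trans _ kn) //.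
  by congr expR; rewrite /hausdorff_node /y; ring.
have v01 n k : (k < n)%N -> 0 < (k.+1%:R / n%:R : R) <= 1.
  move=> kn; have n0 : 0 < n%:R :> R by rewrite ltr0n (leq_ltn_trans _ kn).
  by rewrite divr_gt0 //= ler_pdivrMr // mul1r ler_nat.
have bexp := bounded_expRN x0.
apply/andP; split.
- apply: (@le_trans _ _ (f (j.+2%:R / N.+1%:R))).
    apply: f_ni; first by rewrite divr_gt0.
    rewrite ler_pdivrMr // mulrDl divfK ?gt_eqF // -/y -[j.+2%:R]natr1 -[j.+1%:R]natr1.
    by rewrite -addrA lerD // -natrD lerr.
  rewrite -ulim_hausdorff_pow //; apply: (ulim_le UU).
  + exists (f N.+1%:R^-1) => n.
    rewrite ger0_norm; last first.
      by apply: sumr_ge0 => k _; rewrite mulr_ge0 ?exprn_ge0 ?divr_ge0 ?hausdorff_weight_ge0.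
    rewrite -(sum_hausdorff_weight n h0) big_ord_recl ler_wpDl ?hausdorff_weight_ge0 //.
    apply: ler_sum => k _; rewrite -[leRHS]mulr1 ler_wpM2l ?hausdorff_weight_ge0 //.
    by have /andP[/ltW ? ?] := v01 n k (ltn_ord k); rewrite exprn_ile1.
  + exact: bounded_hausdorff_sum.
  move=> n; apply: ler_sum => k _; rewrite ler_wpM2l ?hausdorff_weight_ge0 // node //.
  have v := v01 n k (ltn_ord k); have /andP[/ltW ? ?] := v.
  by rewrite -powR_mulrn // ger_powR // ltW.
(* Here [j] may be 0, so the comparison is with the full sum, node [k = 0] included. *)
- apply: (@le_trans _ _ (f (j.+1%:R * N.+1%:R^-1))); last first.
    by apply: f_ni => //; rewrite ler_pdivlMr // ltW.
  rewrite -(cvgn_ulim UU oU (@cvg_hausdorff_moment _ j h0)); apply: (ulim_le UU).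
  + exact: bounded_hausdorff_sum.
  + exists (f N.+1%:R^-1) => n.
    have v01' (k : 'I_n.+1) : 0 <= (k%:R / n%:R : R) <= 1.
      case: n k => [|n] k; first by rewrite invr0 mulr0 lexx ler01.
      by rewrite divr_ge0 //= ler_pdivrMr ?ltr0n // mul1r ler_nat -ltnS.
    rewrite ger0_norm; last first.
      by apply: sumr_ge0 => k _; rewrite mulr_ge0 ?exprn_ge0 ?divr_ge0 ?hausdorff_weight_ge0.
    rewrite -(sum_hausdorff_weight n h0).
    apply: ler_sum => k _; rewrite -[leRHS]mulr1 ler_wpM2l ?hausdorff_weight_ge0 //.
    by have /andP[? ?] := v01' k; rewrite exprn_ile1.
  move=> n; rewrite big_ord_recl ler_wpDl //.
    by rewrite mulr_ge0 ?exprn_ge0 ?divr_ge0 ?hausdorff_weight_ge0.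
  apply: ler_sum => k _; rewrite ler_wpM2l ?hausdorff_weight_ge0 // node //.
  have v := v01 n k (ltn_ord k); have /andP[/ltW ? ?] := v.
  by rewrite -powR_mulrn // ger_powR.
Qed.

Lemma hausdorff_functional_exp x : 0 < x -> {for x, continuous f} ->
  hausdorff_functional (fun t => expR (- (x * t))) = f x.
Proof.
move=> x0 fx; apply: (cvgn_ulim UU oU).
apply: (@squeeze_cvgr _ _ _ _ (fun N => f (x + 2 / N.+1%:R)) (fun=> f x)).
- by apply: nearW => N; exact: ulim_hausdorff_exp.
- apply: continuous_cvg => //; rewrite -[X in _ --> X]addr0; apply: cvgD; first exact: cvg_cst.
  rewrite -[X in _ --> X](mulr0 2); apply: cvgM; first exact: cvg_cst.
  exact: cvg_harmonic.
- exact: cvg_cst.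
Qed.

End HausdorffFunctional.

(** * Probability laws from distribution functions *)

Section ProbabilityOfCdf.
Variables (R : realType) (F : R -> R).
Hypotheses (ndF : {homo F : x y / x <= y}) (rcF : forall x, F @ x^'+ --> F x).
Hypotheses (F0 : F @ -oo --> (0 : R)) (F1 : F @ +oo --> (1 : R)).

#[local] HB.instance Definition _ := isCumulative.Build R _ R F ndF rcF.
#[local] HB.instance Definition _ := isCumulativeBounded.Build R 0 1 F F0 F1.

Lemma probability_of_cdf : exists P : probability (measurableTypeR R) R,
  forall r, P `]-oo, r]%classic = (F r)%:E.
Proof.
exists (lebesgue_stieltjes_measure F) => r.
by have := cdf_lebesgue_stieltjes_id F r; rewrite /cdf /= /distribution /pushforward /= preimage_id.
Qed.

End ProbabilityOfCdf.

(** * Step functions approximating exponentials *)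

Section StepFunctions.
Variables (R : realType) (x d : R).
Hypotheses (x0 : 0 < x) (d0 : 0 < d).

Let r : R := expR (- (x * d)).

(** Abel summation: for [H u] the indicator of [t <= u], this is the step function of [t] equal to 1
    up to 0, to [r ^ i] on [](i - 1) d, i d]], and to 0 after [K d]. Leaving [H] free lets the same
    sum serve for indicators, their images under a functional, and distribution functions. *)
Definition step_sum K (H : R -> R) : R :=
  \sum_(i < K) (r ^+ i - r ^+ i.+1) * H (i%:R * d) + r ^+ K * H (K%:R * d).

Definition step_fun K t : R := step_sum K (fun u => (t <= u)%R%:R).

Let r01 : 0 <= r <= 1.
Proof. by rewrite expR_ge0 -expR0 ler_expR oppr_le0 mulr_ge0 // ltW. Qed.

Let rX i : r ^+ i = expR (- (x * (i%:R * d))).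
Proof. by rewrite -expRM_natl; congr expR; rewrite /=; ring. Qed.

Lemma step_sum_le K (H1 H2 : R -> R) : (forall u, 0 <= u -> H1 u <= H2 u) ->
  step_sum K H1 <= step_sum K H2.
Proof.
move=> le12; have /andP[r0 r1] := r01; have i0 (i : nat) : 0 <= i%:R * d by rewrite mulr_ge0 // ltW.
rewrite lerD ?ler_wpM2l ?exprn_ge0 ?le12 //; apply: ler_sum => i _.
by rewrite ler_wpM2l ?le12 // subr_ge0 exprS ler_piMl ?exprn_ge0.
Qed.

Lemma step_fun_bounds K t :
  [/\ t <= K%:R * d -> - d <= t -> expR (- (x * (t + d))) <= step_fun K t,
      t <= K%:R * d -> step_fun K t <= expR (- (x * t)) &
      K%:R * d < t -> step_fun K t = 0].
Proof.
elim: K => [|K [IHl IHu IH0]].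
  rewrite /step_fun /step_sum big_ord0 add0r expr0 !mul0r mul1r; split.
  - move=> -> td; rewrite -expR0 ler_expR oppr_le0 mulr_ge0 ?(ltW x0) //.
    by rewrite -lerBlDr sub0r.
  - by move=> t0; rewrite t0 -expR0 ler_expR oppr_ge0 mulr_ge0_le0 // ltW.
  - by rewrite ltNge => /negbTE ->.
have KS : K%:R * d <= K.+1%:R * d by rewrite ler_pM2r // ler_nat.
have E : step_fun K.+1 t = step_fun K t + r ^+ K.+1 * ((t <= K.+1%:R * d)%R%:R - (t <= K%:R * d)%R%:R).
  by rewrite /step_fun /step_sum big_ord_recr /=; ring.
have [tK|tK] := leP t (K%:R * d).
  have E' : step_fun K.+1 t = step_fun K t by rewrite E (le_trans tK KS) tK subrr mulr0 addr0.
  rewrite E'; split => [_|_|]; [exact: IHl|exact: IHu|].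
  by rewrite ltNge (le_trans tK KS).
have {}E : step_fun K.+1 t = r ^+ K.+1 * (t <= K.+1%:R * d)%R%:R.
  by rewrite E IH0 // (leNgt t (K%:R * d)) tK subr0 add0r.
rewrite E; split.
- move=> -> _; rewrite mulr1 rX ler_expR lerN2 ler_pM2l //.
  by rewrite -natr1 mulrDl mul1r lerD2r ltW.
- by move=> tK1; rewrite tK1 mulr1 rX ler_expR lerN2 ler_pM2l.
- by rewrite ltNge => /negbTE ->; rewrite mulr0.
Qed.

Lemma step_fun_le K t : step_fun K t <= expR (- (x * t)).
Proof.
have [_ H1 H2] := step_fun_bounds K t; have [//|tK] := leP t (K%:R * d).
by rewrite H2 // expR_ge0.
Qed.

Lemma expRN_le_step_fun K t : 0 <= t ->
  expR (- (x * t)) <= expR (x * d) * step_fun K t + expR (- (x * (K%:R * d))).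
Proof.
move=> t0; have [H1 _ H2] := step_fun_bounds K t.
have [tK|tK] := leP t (K%:R * d).
  rewrite ler_wpDr ?expR_ge0 // -ler_pdivrMl ?expR_gt0 // -expRN -expRD.
  have -> : - (x * d) - x * t = - (x * (t + d)) by ring.
  by apply: H1 => //; rewrite (le_trans _ t0) // oppr_le0 ltW.
rewrite H2 // mulr0 add0r ler_expR lerN2 ler_pM2l //.
exact: ltW.
Qed.

Lemma step_fun_shift K t : step_fun K (t - d) = step_sum K (fun u => (t <= u + d)%R%:R).
Proof.
rewrite /step_fun /step_sum; congr (_ + _ * _); last by rewrite lerBlDr.
by apply: eq_bigr => i _; rewrite lerBlDr.
Qed.

End StepFunctions.

(** * From a positive functional to a law *)

Section Representation.
Variables (R : realType) (L : (R -> R) -> R) (f : R -> R).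
Hypotheses (posL : pos_functional L)
  (Lf : forall x, 0 < x -> L (fun t => expR (- (x * t))) = f x)
  (f1 : f x @[x --> (0 : R)^'+] --> (1 : R)).

Let ind u : R -> R := fun t => (t <= u)%R%:R.

Let bounded_ind u : bounded_pos (ind u).
Proof. by exists 1 => t _; rewrite /ind; case: (t <= u); rewrite ?normr1 ?normr0. Qed.

Let boundedD c (phi psi : R -> R) : bounded_pos phi -> bounded_pos psi ->
  bounded_pos (fun t => c * phi t + psi t).
Proof.
move=> [M phiM] [N psiN]; exists (`|c| * M + N) => t t0.
rewrite (le_trans (ler_normD _ _)) // lerD ?psiN // normrM ler_wpM2l //.
exact: phiM.
Qed.

Let bounded_cst c : bounded_pos (fun=> c : R).
Proof. by exists `|c|. Qed.

Let bounded_eq (phi psi : R -> R) : (forall t, phi t = psi t) -> bounded_pos phi -> bounded_pos psi.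
Proof. by move=> /funext ->. Qed.

Let L0 : L (fun=> 0) = 0.
Proof.
have [lin _ _] := posL; have := lin (-1) _ _ (bounded_cst 1) (bounded_cst 1).
rewrite [in RHS]mulN1r [RHS]addNr => E; rewrite -[RHS]E.
by congr L; apply/funext => t; rewrite mulN1r addNr.
Qed.

Let LD phi psi : bounded_pos phi -> bounded_pos psi ->
  L (fun t => phi t + psi t) = L phi + L psi.
Proof.
move=> bphi bpsi; have [lin _ _] := posL.
rewrite -[L phi]mul1r -lin //; congr L; apply/funext => t; by rewrite mul1r.
Qed.

Let LZ c phi : bounded_pos phi -> L (fun t => c * phi t) = c * L phi.
Proof.
move=> bphi; have [lin _ _] := posL.
rewrite -[RHS]addr0 -L0 -lin //; congr L; apply/funext => t; by rewrite addr0.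
Qed.

Let L_sum K (c u : nat -> R) :
  bounded_pos (fun t => \sum_(i < K) c i * ind (u i) t) /\
  L (fun t => \sum_(i < K) c i * ind (u i) t) = \sum_(i < K) c i * L (ind (u i)).
Proof.
elim: K => [|K [bK LK]].
  rewrite big_ord0; have E : (fun t => \sum_(i < 0) c i * ind (u i) t) = fun=> 0.
    by apply/funext => t; rewrite big_ord0.
  by rewrite E.
have E : (fun t => \sum_(i < K.+1) c i * ind (u i) t) =
    (fun t => c K * ind (u K) t + \sum_(i < K) c i * ind (u i) t).
  by apply/funext => t; rewrite big_ord_recr addrC.
have [lin _ _] := posL.
rewrite E big_ord_recr /= -LK [RHS]addrC; split; last exact: lin.
exact: boundedD.
Qed.

Let L_step x d K s :
  bounded_pos (fun t => step_sum x d K (fun u => ind (u + s) t)) /\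
  L (fun t => step_sum x d K (fun u => ind (u + s) t)) = step_sum x d K (fun u => L (ind (u + s))).
Proof.
have [b e] := L_sum K (fun i => expR (- (x * d)) ^+ i - expR (- (x * d)) ^+ i.+1) (fun i => i%:R * d + s).
have bind : bounded_pos (fun t => expR (- (x * d)) ^+ K * ind (K%:R * d + s) t).
  by apply: bounded_eq (boundedD (expR (- (x * d)) ^+ K) (bounded_ind (K%:R * d + s)) (bounded_cst 0)) => t; rewrite addr0.
split.
  by apply: bounded_eq (boundedD 1 b bind) => t; rewrite mul1r.
by rewrite /step_sum LD // e LZ.
Qed.

Let G u := L (ind u).

Let G_nd u v : u <= v -> G u <= G v.
Proof.
move=> uv; have [_ mono _] := posL; apply: mono => // t _; rewrite /ind.
by case: (leP t u) => // tu; rewrite (le_trans tu uv).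
Qed.

Let G_lt0 u : u < 0 -> G u = 0.
Proof.
move=> u0; have [_ mono _] := posL; apply/eqP; rewrite eq_le.
apply/andP; split; rewrite -L0; apply: mono => // t t0; rewrite /ind.
by rewrite (leNgt t u) (lt_le_trans u0 t0).
Qed.

Let G_ge0 u : 0 <= G u.
Proof. by have [_ mono _] := posL; rewrite -L0; apply: mono => // t _; rewrite /ind ler0n. Qed.

Let G_le1 u : G u <= 1.
Proof.
have [_ mono le1] := posL; apply: le_trans le1; apply: mono => // t _.
by rewrite /ind lern1 leq_b1.
Qed.

(** A Chebyshev bound: for [t >= 0], [expR (- (x * t))] is at most [expR (- (x * u))] plus the
    indicator of [t <= u]. As [f] tends to 1 at 0, no mass escapes to infinity. *)
Let G_tail x u : 0 < x -> 0 <= u -> f x - expR (- (x * u)) <= G u.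
Proof.
move=> x0 u0; have [lin mono le1] := posL.
rewrite lerBlDr -Lf // addrC.
apply: (@le_trans _ _ (expR (- (x * u)) * L (fun=> 1) + G u)); last first.
  by rewrite lerD2r ler_piMr ?expR_ge0.
rewrite -lin //; apply: mono => [||t t0].
- exact: bounded_expRN.
- exact: boundedD.
rewrite /ind mulr1; case: (leP t u) => [tu|ut] /=.
  by rewrite ler_wpDl ?expR_ge0 // -expR0 ler_expR oppr_le0 mulr_ge0 // ltW.
by rewrite addr0 ler_expR lerN2 ler_pM2l // ltW.
Qed.

(** [L] may be only finitely additive, so [G] may fail to be right-continuous; right limits repair
    this. The result at [t] lies between [G t] and [G u] for every [u > t]. *)
Definition right_limit_cdf t : R := inf (G @` [set u | t < u]).

Let F := right_limit_cdf.

Let G_lb t : has_lbound (G @` [set u | t < u]).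
Proof. by exists 0 => _ [u _ <-]. Qed.

Let FG t u : t < u -> F t <= G u.
Proof. by move=> tu; apply: ge_inf; [exact: G_lb|exists u]. Qed.

Let le_F t c : (forall u, t < u -> c <= G u) -> c <= F t.
Proof.
move=> H; apply: lb_le_inf; last by move=> _ [u tu <-]; exact: H.
by exists (G (t + 1)), (t + 1) => //=; rewrite ltrDl.
Qed.

Let GF t : G t <= F t.
Proof. by apply: le_F => u /ltW; exact: G_nd. Qed.

Let F_nd : {homo F : s t / s <= t}.
Proof. by move=> s t st; apply: le_F => u tu; apply: FG; apply: le_lt_trans tu. Qed.

Let F_lt0 t : t < 0 -> F t = 0.
Proof.
move=> t0; apply/eqP; rewrite eq_le (le_trans (G_ge0 _) (GF t)) andbT.
have t2 : t < t / 2 by lra.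
rewrite -(@G_lt0 (t / 2)); first exact: FG.
by rewrite ltr_pdivrMr // mul0r.
Qed.

Let F_le1 t : F t <= 1.
Proof. by apply: le_trans (@FG t (t + 1) _) (G_le1 _); rewrite ltrDl. Qed.

Let F_rc t : F @ t^'+ --> F t.
Proof.
apply/cvgrPdist_lt => e e0.
have [||y [u /= tu <-] Gu] := @inf_lt _ (G @` [set u | t < u]) (F t + e).
- by exists (G (t + 1)), (t + 1) => //=; rewrite ltrDl.
- by rewrite ltrDl.
near=> s; have ts : t < s by [].
have su : s < u by near: s; exact: nbhs_right_lt.
rewrite distrC ger0_norm ?subr_ge0; last exact: F_nd (ltW ts).
by rewrite ltrBlDl (le_lt_trans (FG su)).
Unshelve. all: end_near. Qed.

Let F_Ny : F @ -oo --> (0 : R).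
Proof.
apply/cvgrPdist_lt => e e0; near=> t.
by rewrite F_lt0 ?subrr ?normr0.
Unshelve. all: end_near. Qed.

Let F_y : F @ +oo --> (1 : R).
Proof.
apply/cvgrPdist_lt => e e0.
have e20 : 0 < e / 2 by rewrite divr_gt0.
have /cvgrPdist_lt/(_ _ e20) H := f1.
have [x [x0 fx]] : exists x, 0 < x /\ `|1 - f x| < e / 2.
  by near (0 : R)^'+ => x; exists x; split => //; near: x.
near=> t; have t0 : 0 <= t by near: t; apply: nbhs_pinfty_ge; exact: num_real.
rewrite ger0_norm ?subr_ge0 ?F_le1 //.
have : expR (- (x * t)) < e / 2.
  rewrite -ltr_ln ?posrE ?expR_gt0 // expRK -ltrN2 opprK -ltr_pdivrMl //.
  by near: t; apply: nbhs_pinfty_gt; exact: num_real.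
have := le_trans (G_tail x0 t0) (GF t).
move: fx; rewrite ltr_norml => /andP[_ fx]; move: fx; lra.
Unshelve. all: end_near. Qed.

Section Law.
Variables (P : probability (measurableTypeR R) R).
Hypothesis PF : forall r, P `]-oo, r]%classic = (F r)%:E.

Let P_neg : P `]-oo, 0[%classic = 0%E.
Proof.
have E : (`]-oo, 0[%classic : set R) = \bigcup_n `]-oo, - n.+1%:R^-1]%classic.
  apply/seteqP; split => t /=; rewrite ?in_itv /=.
    move=> t0; exists (Num.truncn (- t)^-1) => //=; rewrite in_itv /= lerNr.
    rewrite -[leRHS]invrK lef_pV2 ?posrE ?invr_gt0 ?oppr_gt0 //.
    exact: ltW (truncnS_gt _).
  by move=> [n _] /=; rewrite in_itv /= => /le_lt_trans; apply; rewrite oppr_lt0 invr_gt0.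
apply/negligibleP; first exact: measurable_itv.
rewrite E; apply: negligible_bigcup => n; apply/negligibleP; first exact: measurable_itv.
apply: etrans (PF _) _; by rewrite F_lt0 // oppr_lt0 invr_gt0.
Qed.

Lemma on_halfline_law : on_halfline P.
Proof.
rewrite /on_halfline -(setCitvl) probability_setC //.
by rewrite P_neg sube0.
Qed.

Let D : set R := `[0, +oo[%classic.

Let mD : measurable (D : set (measurableTypeR R)).
Proof. exact: measurable_itv. Qed.

Let PD r : 0 <= r -> P (`]-oo, r]%classic `&` D) = (F r)%:E.
Proof.
move=> r0; rewrite -PF -(@measureU0 _ _ _ P _ `]-oo, 0[%classic) //.
- congr (P _); apply/seteqP; split => t /=; rewrite /D /= !in_itv /= ?andbT.
    by move=> [[]//|/ltW/le_trans]; apply.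
  by move=> tr; case: (leP 0 t) => t0; [left|right].
- by apply: measurableI => //; exact: measurable_itv.
Qed.

Let integrable_bounded (g : measurableTypeR R -> R) M : measurable_fun setT g ->
  (forall t, D t -> `|g t| <= M) -> P.-integrable D (EFin \o g).
Proof.
move=> mg gM; apply: measurable_bounded_integrable => //.
- by rewrite (le_lt_trans (probability_le1 _ _)) ?ltry.
- exact: measurable_funTS.
rewrite /bounded_near; near=> N => t Dt /=; apply: le_trans (gM t Dt) _.
near: N; apply: nbhs_pinfty_ge; exact: num_real.
Unshelve. all: end_near. Qed.

Let integrable_ind u : P.-integrable D (EFin \o (ind u : measurableTypeR R -> R)).
Proof.
apply: (@integrable_bounded _ 1) => [|t _]; last first.
  by rewrite /ind; case: (t <= u); rewrite ?normr1 ?normr0.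
rewrite (_ : ind u = \1_(`]-oo, u]%classic)); first exact: measurable_indic.
by apply/funext => t; rewrite /ind indicE mem_setE /= in_itv.
Qed.

Let Rint_ind u : 0 <= u -> \int[P]_(t in D) ind u t = F u.
Proof.
move=> u0; rewrite -[RHS]/(fine (F u)%:E) -PD // -integral_indic //.
congr fine; apply: eq_integral => t _.
by rewrite /ind indicE mem_setE /= in_itv.
Qed.

Let Rint_sum K (c u : nat -> R) : (forall i, 0 <= u i) ->
  P.-integrable D (EFin \o (fun t : measurableTypeR R => \sum_(i < K) c i * ind (u i) t)) /\
  \int[P]_(t in D) (\sum_(i < K) c i * ind (u i) t) = \sum_(i < K) c i * F (u i).
Proof.
move=> u0; elim: K => [|K [iK LK]].
  rewrite big_ord0; have E : (fun t => \sum_(i < 0) c i * ind (u i) t) = fun=> 0.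
    by apply/funext => t; rewrite big_ord0.
  rewrite E; split; last by rewrite Rintegral_cst // mul0r.
  by apply: (@integrable_bounded _ 0) => [|t _]; [exact: measurable_cst|rewrite normr0].
have iZ : P.-integrable D (EFin \o (fun t : measurableTypeR R => c K * ind (u K) t)).
  exact: (integrableZl mD (c K) (integrable_ind (u K))).
have E : (fun t => \sum_(i < K.+1) c i * ind (u i) t) =
    (fun t => \sum_(i < K) c i * ind (u i) t + c K * ind (u K) t).
  by apply/funext => t; rewrite big_ord_recr.
rewrite E big_ord_recr /= -LK; split; first exact: (integrableD mD iK iZ).
by rewrite RintegralD // RintegralZl ?Rint_ind.
Qed.

Let Rint_step x d K : 0 < d ->
  P.-integrable D (EFin \o (step_fun x d K : measurableTypeR R -> R)) /\
  \int[P]_(t in D) step_fun x d K t = step_sum x d K F.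
Proof.
move=> d0; have u0 i : 0 <= i%:R * d by rewrite mulr_ge0 // ltW.
pose r := expR (- (x * d)).
have [i e] := Rint_sum K (fun i => r ^+ i - r ^+ i.+1) u0.
have iZ : P.-integrable D (EFin \o (fun t : measurableTypeR R => r ^+ K * ind (K%:R * d) t)).
  exact: (integrableZl mD _ (integrable_ind _)).
split; first exact: (integrableD mD i iZ).
rewrite /step_fun /step_sum RintegralD // e RintegralZl ?Rint_ind //.
exact: integrable_ind.
Qed.

Let integrable_exp x : 0 < x ->
  P.-integrable D (EFin \o (fun t : measurableTypeR R => expR (- (x * t)))).
Proof.
move=> x0; apply: (@integrable_bounded _ 1).
  apply: continuous_measurable_fun => t.
  apply: (@continuous_comp _ _ _ (fun t : R => - (x * t)) expR); last exact: continuous_expR.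
  by apply: cvgN; apply: cvgM; [exact: cvg_cst|exact: cvg_id].
move=> t; rewrite /D /= in_itv /= andbT => t0.
by rewrite ger0_norm ?expR_ge0 // -expR0 ler_expR oppr_le0 mulr_ge0 // ltW.
Qed.

(** [laplace P] and [L] are compared on step functions of mesh [1 / (n + 1)] up to [n + 1], hence
    with [(n + 1) ^ 2] cells. The factor [e n] pays for the mesh and tends to 1; [z n] pays for the
    tail and tends to 0. *)
Lemma laplace_law x : 0 < x -> laplace P x = f x.
Proof.
move=> x0.
pose e n : R := expR (x * n.+1%:R^-1).
pose z n : R := expR (- (x * n.+1%:R)).
have d0 n : 0 < n.+1%:R^-1 :> R by rewrite invr_gt0.
have Kd n : (n.+1 * n.+1)%:R * n.+1%:R^-1 = n.+1%:R :> R.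
  by rewrite natrM mulfK // pnatr_eq0.
have [lin mono le1] := posL.
have up n : laplace P x <= e n * (e n * f x) + z n.
  have [i1 e1] := Rint_step x (n.+1 * n.+1) (d0 n).
  apply: (@le_trans _ _ (e n * step_sum x n.+1%:R^-1 (n.+1 * n.+1) F + z n)).
    have iZ : P.-integrable D (EFin \o (fun t : measurableTypeR R =>
        e n * step_fun x n.+1%:R^-1 (n.+1 * n.+1) t)).
      exact: (integrableZl mD _ i1).
    have ic : P.-integrable D (EFin \o (fun t : measurableTypeR R => z n)).
      by apply: (@integrable_bounded _ `|z n|) => //; exact: measurable_cst.
    apply: (@le_trans _ _ (\int[P]_(t in D)
        (e n * step_fun x n.+1%:R^-1 (n.+1 * n.+1) t + z n))).
      apply: le_Rintegral => //; first exact: integrable_exp.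
        exact: (integrableD mD iZ ic).
      move=> t; rewrite /D /= in_itv /= andbT => t0.
      by have := expRN_le_step_fun x0 (d0 n) (n.+1 * n.+1) t0; rewrite Kd.
    rewrite RintegralD // RintegralZl // e1 lerD2l Rintegral_cst //.
    rewrite -[leRHS]mulr1 ler_wpM2l ?expR_ge0 //.
    by rewrite -lee_fin fineK; [exact: probability_le1|exact: fin_num_measure].
  rewrite lerD2r ler_wpM2l ?expR_ge0 //.
  (* Bounding [F u] by [G] one mesh further translates the step function by the mesh, which costs a
     second factor [e n]. *)
  apply: le_trans (_ : step_sum x n.+1%:R^-1 (n.+1 * n.+1) (fun u => G (u + n.+1%:R^-1)) <= _).
    by apply: step_sum_le => // u u0; apply: FG; rewrite ltrDl.
  have [b2 e2] := L_step x n.+1%:R^-1 (n.+1 * n.+1) n.+1%:R^-1.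
  rewrite -e2 -Lf // -LZ; last exact: bounded_expRN.
  apply: mono => // [|t t0].
    by apply: bounded_eq (boundedD (e n) (bounded_expRN x0) (bounded_cst 0)) => t; rewrite addr0.
  rewrite -step_fun_shift (le_trans (step_fun_le x0 (d0 n) _ _)) // -expRD ler_expR.
  by rewrite mulrBr opprB.
have low n : f x <= e n * laplace P x + z n.
  have [i1 e1] := Rint_step x (n.+1 * n.+1) (d0 n).
  apply: (@le_trans _ _ (e n * step_sum x n.+1%:R^-1 (n.+1 * n.+1) F + z n)); last first.
    rewrite lerD2r ler_wpM2l ?expR_ge0 // -e1; apply: le_Rintegral => //; first exact: integrable_exp.
    by move=> t _; exact: step_fun_le.
  apply: (@le_trans _ _ (e n * step_sum x n.+1%:R^-1 (n.+1 * n.+1) G + z n)); last first.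
    by rewrite lerD2r ler_wpM2l ?expR_ge0 // step_sum_le // => u _; exact: GF.
  have [b2 e2] := L_step x n.+1%:R^-1 (n.+1 * n.+1) 0.
  have {}e2 : L (step_fun x n.+1%:R^-1 (n.+1 * n.+1)) = step_sum x n.+1%:R^-1 (n.+1 * n.+1) G.
    rewrite (_ : G = fun u => L (ind (u + 0))); last by apply/funext => u; rewrite addr0.
    rewrite -e2; congr L; apply/funext => t; rewrite /step_fun; congr step_sum.
    by apply/funext => u; rewrite addr0.
  have {}b2 : bounded_pos (step_fun x n.+1%:R^-1 (n.+1 * n.+1)).
    apply: bounded_eq b2 => t; rewrite /step_fun; congr step_sum.
    by apply/funext => u; rewrite addr0.
  rewrite -e2 -Lf //.
  apply: (@le_trans _ _ (e n * L (step_fun x n.+1%:R^-1 (n.+1 * n.+1)) + L (fun=> z n))).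
    rewrite -lin //; apply: mono; [exact: bounded_expRN|exact: boundedD|move=> t t0].
    have := expRN_le_step_fun x0 (d0 n) (n.+1 * n.+1) t0.
    by rewrite Kd.
  rewrite lerD2l (_ : (fun=> z n) = fun t => z n * (fun=> 1) t); last first.
    by apply/funext => t; rewrite mulr1.
  by rewrite LZ // ler_piMr ?expR_ge0.
have ce : e n @[n --> \oo] --> (1 : R).
  have c0 : x * n.+1%:R^-1 @[n --> \oo] --> x * 0.
    by apply: cvgM; [exact: cvg_cst|exact: cvg_harmonic].
  have := cvg_comp _ _ c0 (@continuous_expR R (x * 0)).
  by rewrite mulr0 expR0.
have cz : z n @[n --> \oo] --> (0 : R).
  rewrite /z; apply: (@cvg_comp _ _ _ (fun n => x * n.+1%:R) (fun y => expR (- y)) _ (pinfty_nbhs R)).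
    apply/cvgryPge => A; near=> n; rewrite -ler_pdivrMl //.
    by apply: (@le_trans _ _ n%:R); [near: n; exact: nbhs_infty_ger|rewrite ler_nat].
  exact: cvgr_expR.
apply/eqP; rewrite eq_le; apply/andP; split.
  have c : e n * (e n * f x) + z n @[n --> \oo] --> 1 * (1 * f x) + 0.
    by apply: cvgD => //; apply: cvgM => //; apply: cvgM => //; exact: cvg_cst.
  rewrite -[leRHS]mul1r -[leRHS]mul1r -[leRHS]addr0; apply: (cvgr_to_ge c).
  exact: nearW.
have c : e n * laplace P x + z n @[n --> \oo] --> 1 * laplace P x + 0.
  by apply: cvgD => //; apply: cvgM => //; exact: cvg_cst.
rewrite -[leRHS]mul1r -[leRHS]addr0; apply: (cvgr_to_ge c).
exact: nearW.
Unshelve. all: end_near.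
Qed.

End Law.

Lemma laplace_representation : exists2 P : probability (measurableTypeR R) R,
  on_halfline P & forall x, 0 < x -> laplace P x = f x.
Proof.
have [P PF] := probability_of_cdf F_nd F_rc F_Ny F_y.
by exists P; [exact: on_halfline_law|move=> x; exact: laplace_law].
Qed.

End Representation.

Section BernsteinTheorem.
Variable R : realType.

Lemma bernstein_theorem (f : R -> R) : cmono f ->
  (forall x, 0 < x -> {for x, continuous f}) -> f x @[x --> (0 : R)^'+] --> (1 : R) ->
  exists2 P : probability (measurableTypeR R) R,
    on_halfline P & forall x, 0 < x -> laplace P x = f x.
Proof.
move=> cf contf f1.
have f_le1 x : 0 < x -> f x <= 1.
  move=> x0; apply: (cvgr_to_ge f1); near=> y.
  have y0 : 0 < y by [].
  have yx : y < x by near: y; exact: nbhs_right_lt.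
  have := cf 1%N (x - y) y; rewrite /= /diff subrKC subr_ge0 subr_gt0; exact.
have [U [UU oU]] := ultraFilterLemma (@eventually_filter).
apply: (laplace_representation (pos_hausdorff_functional cf f_le1 UU)) => // x x0.
by apply: hausdorff_functional_exp => //; exact: contf.
Unshelve. all: end_near. Qed.

End BernsteinTheorem.

(** * Convolution with an exponential law *)

Section ExponentialConvolution.
Variables (R : realType) (c : R).
Notation mu := (@lebesgue_measure R).
Notation M := (measurableTypeR R).

(* For [u] uniform on [0, 1], [- ln u / c] has the exponential law of rate [c];
   the absolute values make the sum nonnegative everywhere. *)
Definition add_exponential (z : M * M) : M := `|z.1| + `|ln z.2| / c.

Lemma measurable_add_exponential : measurable_fun setT add_exponential.
Proof.
apply: measurable_funD.
  apply: measurableT_comp => //; exact: measurable_fst.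
apply: measurable_funM; last exact: measurable_cst.
apply: measurableT_comp => //; apply: measurableT_comp; first exact: measurable_ln.
exact: measurable_snd.
Qed.

HB.instance Definition _ :=
  isMeasurableFun.Build _ _ _ _ add_exponential measurable_add_exponential.

Variables (P : probability M R).
Hypotheses (c0 : 0 < c) (P0 : on_halfline P).

Notation U := (uniform_prob (@ltr01 R)).

Definition exponential_convolution : probability M R :=
  distribution (P \x U)%E (add_exponential : {RV (P \x U)%E >-> M}).

Lemma on_halfline_exponential_convolution : on_halfline exponential_convolution.
Proof.
rewrite /on_halfline /exponential_convolution /distribution /= /pushforward.
rewrite (_ : _ @^-1` _ = setT); first exact: probability_setT.
apply/seteqP; split => z //= _; rewrite in_itv /= andbT /add_exponential.
by rewrite addr_ge0 // divr_ge0 // ltW.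
Qed.

Let fexp (x : R) : R -> R := fun t => expR (- (x * `|t|)).

Let measurable_fexp x : measurable_fun setT (fexp x).
Proof.
apply: continuous_measurable_fun => t.
apply: (@continuous_comp _ _ _ (fun t : R => - (x * `|t|)) expR); last exact: continuous_expR.
by apply: cvgN; apply: cvgM; [exact: cvg_cst|exact: norm_continuous].
Qed.

(** On ]0, 1] the integrand is the power of [u] with exponent [x / c]; its integral is the Laplace
    transform of the exponential law of rate [c]. *)
Let uniform_exp x : 0 < x ->
  (\int[U]_u (fexp (x / c) (ln u))%:E = ((1 + x / c)^-1)%:E)%E.
Proof.
move=> x0; have p0 : 0 < x / c by rewrite divr_gt0.
have p10 : 0 < 1 + x / c by rewrite addr_gt0.
rewrite integral_uniform; last 2 first.
- apply/measurable_EFinP; apply: measurableT_comp; [exact: measurable_fexp|exact: measurable_ln].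
- by move=> u; rewrite lee_fin expR_ge0.
rewrite subr0 invr1 mul1e -integral_itv_obnd_cbnd; last first.
  apply/measurable_EFinP/measurable_funTS.
  by apply: measurableT_comp; [exact: measurable_fexp|exact: measurable_ln].
transitivity (\int[mu]_(u in `]0%R, 1%R]) (u `^ (x / c))%:E)%E.
  apply: eq_integral => u; rewrite inE /= in_itv /= => /andP[u0 u1].
  rewrite /fexp /powR gt_eqF // ler0_norm ?ln_le0 //.
  by congr (expR _)%:E; ring.
have dF (u : R) : 0 < u -> is_derive u (1 : R) (fun v => (1 + x / c)^-1 * v `^ (1 + x / c)) (u `^ (x / c)).
  move=> u0; apply: (@is_derive_eq _ _ _ _ _ _ _ _ (is_derive1Z _ (is_derive1_powR _ u0))).
  by rewrite mulrA mulVf ?gt_eqF // mul1r [1 + _]addrC addrK.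
have cpow' (p : R) (v : R) : 0 < v -> {for v, continuous (fun v : R => v `^ p)}.
  move=> v0; apply: differentiable_continuous; apply/derivable1_diffP.
  by have [] := is_derive1_powR p v0.
have cpow0 (p : R) : 0 < p -> v `^ p @[v --> (0 : R)^'+] --> (0 : R) `^ p.
  by move=> q0; rewrite powR0 ?gt_eqF //; exact: powR_cvg0.
rewrite integral_itv_obnd_cbnd; last first.
  apply/measurable_EFinP; apply: measurable_funTS; exact: measurable_powR.
rewrite (@continuous_FTC2 _ _ (fun v => (1 + x / c)^-1 * v `^ (1 + x / c))) //.
- by rewrite powR1 powR0 ?gt_eqF // mulr0 mulr1 sube0.
- apply/continuous_within_itvP => //; split.
  + by move=> v; rewrite in_itv /= => /andP[v0 _]; exact: cpow'.
  + exact: cpow0.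
  + by apply: cvg_at_left_filter; exact: cpow'.
- split.
  + by move=> v; rewrite in_itv /= => /andP[v0 _]; have [] := dF v v0.
  + by apply: cvgM; [exact: cvg_cst|exact: cpow0].
  + by apply: cvgM; [exact: cvg_cst|apply: cvg_at_left_filter; exact: cpow'].
- by move=> v; rewrite in_itv /= => /andP[v0 _]; rewrite derive1E; have [] := dF v v0.
Qed.

Lemma laplace_exponential_convolution x : 0 < x ->
  laplace exponential_convolution x = laplace P x / (1 + x / c).
Proof.
move=> x0; rewrite /laplace.
have mg : measurable_fun setT (fun s : M => (fexp x s)%:E).
  by apply/measurable_EFinP; exact: measurable_fexp.
have toe (Q : probability M R) :
    (\int[Q]_(t in `[0%R, +oo[) (expR (- (x * t)))%:E = \int[Q]_(t in `[0%R, +oo[) (fexp x t)%:E)%E.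
  apply: eq_integral => t; rewrite inE /= in_itv /= andbT => t0.
  by rewrite /fexp ger0_norm.
rewrite /Rintegral !toe.
have P_neg : P (~` `[0, +oo[%classic) = 0%E.
  by rewrite probability_setC ?P0 ?subee //; exact: measurable_itv.
have onP : (\int[P]_t (fexp x t)%:E = \int[P]_(t in `[0%R, +oo[) (fexp x t)%:E)%E.
  rewrite (@ge0_negligible_integral _ _ _ P setT (~` `[0, +oo[%classic)) //.
  - by rewrite setTD setCK.
  - by apply: measurableC; exact: measurable_itv.
  - by move=> t _; rewrite lee_fin expR_ge0.
suff -> : (\int[exponential_convolution]_(t in `[0%R, +oo[) (fexp x t)%:E =
   ((1 + x / c)^-1)%:E * \int[P]_(t in `[0%R, +oo[) (fexp x t)%:E)%E.
  rewrite fineM //; first by rewrite mulrC.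
  apply: integrable_fin_num => //; apply: measurable_bounded_integrable => //.
  - by rewrite (le_lt_trans (probability_le1 _ _)) ?ltry.
  - by apply: measurable_funTS; exact: measurable_fexp.
  - rewrite /bounded_near; near=> N => t _ /=.
    apply: (@le_trans _ _ 1); last by near: N; apply: nbhs_pinfty_ge; exact: num_real.
    rewrite ger0_norm ?expR_ge0 // -expR0 ler_expR oppr_le0 mulr_ge0 // ltW //.
rewrite -onP ge0_integral_pushforward //=; last 2 first.
- exact: measurable_funTS.
- by move=> t _; rewrite lee_fin expR_ge0.
have -> : add_exponential @^-1` `[0, +oo[ = setT.
  apply/seteqP; split => z //= _; rewrite in_itv /= andbT /add_exponential.
  by rewrite addr_ge0 // divr_ge0 // ltW.
rewrite fubini_tonelli1; last 2 first.
- by apply/measurable_EFinP; apply: measurableT_comp; [exact: measurable_fexp|exact: measurable_add_exponential].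
- by move=> z; rewrite lee_fin expR_ge0.
rewrite -ge0_integralZl //; last 2 first.
- by move=> t _; rewrite lee_fin expR_ge0.
- by rewrite lee_fin invr_ge0 addr_ge0 // divr_ge0 // ltW.
apply: eq_integral => t _; rewrite /fubini_F -uniform_exp // muleC -ge0_integralZl //.
- apply: eq_integral => u _; rewrite -EFinM /fexp -expRD; congr (expR _)%:E.
  rewrite /add_exponential /= [`|_ + _|]ger0_norm; last by rewrite addr_ge0 // divr_ge0 // ltW.
  by ring.
- by apply/measurable_EFinP; apply: measurableT_comp; [exact: measurable_fexp|exact: measurable_ln].
- by move=> u _; rewrite lee_fin expR_ge0.
- by rewrite lee_fin expR_ge0.
Unshelve. all: end_near. Qed.

Lemma exponential_convolution_gt0 (t e : R) : 0 <= t -> 0 < e ->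
  (0 < P `[0%R, e[%classic)%E -> (0 < exponential_convolution `[t, (t + (e + e))%R[%classic)%E.
Proof.
move=> t0 e0 Pe.
(* For [u] in [B] the value [- ln u / c] lies in [t, t + e[; [B] is an interval of positive length
   inside [0, 1]. *)
pose B : set R := `]expR (- (c * (t + e))), expR (- (c * t))]%classic.
have le1 : expR (- (c * t)) <= 1 by rewrite -expR0 ler_expR oppr_le0 mulr_ge0 // ltW.
have lt1 : expR (- (c * (t + e))) < expR (- (c * t)).
  by rewrite ltr_expR ltrN2 ltr_pM2l // ltrDl.
have UB : (0 < U B)%E.
  rewrite /uniform_prob (eq_integral (fun=> 1%E)); last first.
    move=> u; rewrite inE /B /= in_itv /= => /andP[u1 u2]; rewrite /uniform_pdf.
    by rewrite (ltW (lt_trans (expR_gt0 _) u1)) (le_trans u2 le1) subr0 invr1.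
  rewrite integral_cst /B; last exact: measurable_itv.
  by rewrite mul1e /= lebesgue_measure_itv /= lte_fin lt1 -EFinB lte_fin subr_gt0.
apply: (@lt_le_trans _ _ ((P \x U)%E (`[0%R, e[%classic `*` B))).
  by rewrite product_measure1E ?mule_gt0 //; exact: measurable_itv.
rewrite /exponential_convolution /distribution /= /pushforward.
apply: le_measure; rewrite ?inE.
- by apply: measurableX; exact: measurable_itv.
- rewrite -[X in measurable X]setTI; apply: measurable_add_exponential => //; exact: measurable_itv.
move=> [s u] []; rewrite /B /= !in_itv /= => /andP[s0 se] /andP[u1 u2].
have u0 : 0 < u by apply: lt_trans u1; exact: expR_gt0.
rewrite /add_exponential /= ger0_norm // ler0_norm; last by rewrite ln_le0 // (le_trans u2).
have l1 : - ln u < c * (t + e) by rewrite ltrNl -[ltLHS]expRK ltr_ln ?posrE ?expR_gt0.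
have l2 : c * t <= - ln u by rewrite lerNr -[leRHS]expRK ler_ln ?posrE ?expR_gt0.
apply/andP; split.
  by rewrite ler_wpDl // ler_pdivlMr // mulrC.
have l3 : - ln u / c < t + e by rewrite ltr_pdivrMr // mulrC.
by rewrite addrA addrC ltrD.
Qed.

End ExponentialConvolution.

(** * The hypergeometric series of Bessel functions *)

Section HypergeometricSeries.
Variable R : realType.
Implicit Types (s x y : R).

Definition pochhammer s k : R := \prod_(i < k) (s + i%:R).

Definition hyp_coef s k : R := (4 ^+ k * k`!%:R * pochhammer s k)^-1.

(* [I_nu(x)] is [(x/2)^nu / Gamma(nu + 1)] times [hyp (nu + 1) (x^2)]. *)
Definition hyp s y : R := limn (pseries (hyp_coef s) y).

Lemma pochhammerS s k : pochhammer s k.+1 = pochhammer s k * (s + k%:R).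
Proof. by rewrite /pochhammer big_ord_recr. Qed.

Lemma pochhammerSl s k : pochhammer s k.+1 = s * pochhammer (s + 1) k.
Proof.
rewrite /pochhammer big_ord_recl addr0; congr (_ * _).
by apply: eq_bigr => i _; rewrite /bump /= natrD addrA.
Qed.

Lemma pochhammer_gt0 s k : 0 < s -> 0 < pochhammer s k.
Proof. by move=> s0; apply: prodr_gt0 => i _; rewrite ltr_wpDr. Qed.

Lemma hyp_coef0 s : hyp_coef s 0 = 1.
Proof. by rewrite /hyp_coef /pochhammer big_ord0 expr0 fact0 !mulr1 invr1. Qed.

Lemma hyp_coef_gt0 s k : 0 < s -> 0 < hyp_coef s k.
Proof.
by move=> s0; rewrite invr_gt0 !mulr_gt0 ?exprn_gt0 ?ltr0n ?fact_gt0 // pochhammer_gt0.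
Qed.

Lemma hyp_coefS s k : hyp_coef s k.+1 = hyp_coef s k / (4 * k.+1%:R * (s + k%:R)).
Proof.
rewrite /hyp_coef pochhammerS exprS factS natrM -invfM; congr (_^-1); ring.
Qed.

Lemma hyp_coef_diffs s : 0 < s ->
  pseries_diffs (hyp_coef s) = (fun k => (4 * s)^-1 * hyp_coef (s + 1) k).
Proof.
move=> s0; apply/funext => k; rewrite /pseries_diffs /hyp_coef pochhammerSl exprS factS.
have p0 : pochhammer (s + 1) k != 0 by rewrite gt_eqF // pochhammer_gt0 // addr_gt0.
have f0 : k`!%:R != 0 :> R by rewrite pnatr_eq0 -lt0n fact_gt0.
have e0 : (4 : R) ^+ k != 0 by rewrite expf_neq0.
by rewrite natrM; field; rewrite p0 f0 e0 gt_eqF //= pnatr_eq0.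
Qed.

(** After multiplication by [k!] the coefficients start with 1 and [1 / (4 s)] and do not increase
    from [k = 1] on. Comparison with the exponential series then gives convergence. *)
Lemma hyp_coef_le s k : 0 < s -> hyp_coef s k <= (1 + (4 * s)^-1) / k`!%:R.
Proof.
move=> s0; have h0 : 0 <= (4 * s)^-1 by rewrite invr_ge0 mulr_ge0 // ltW.
have f0 n : n`!%:R != 0 :> R by rewrite pnatr_eq0 -lt0n fact_gt0.
rewrite ler_pdivlMr ?ltr0n ?fact_gt0 //.
have cS n : hyp_coef s n.+1 * n.+1`!%:R = hyp_coef s n * n`!%:R / (4 * (s + n%:R)).
  have sn0 : s + n%:R != 0 by rewrite gt_eqF // ltr_wpDr.
  rewrite hyp_coefS factS natrM; field.
  by rewrite sn0 nat1r pnatr_eq0.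
case: k => [|k]; first by rewrite hyp_coef0 fact0 mulr1 lerDl.
elim: k => [|k IH].
  by rewrite cS hyp_coef0 fact0 addr0 !mul1r lerDr.
rewrite cS (le_trans _ IH) // ler_pdivrMr; last by rewrite mulr_gt0 // ltr_wpDr.
rewrite ler_peMr //; first by rewrite mulr_ge0 // ltW // hyp_coef_gt0.
have : 1 <= k.+1%:R :> R by rewrite ler1n.
by move: s0; lra.
Qed.

Lemma is_cvg_hyp s y : 0 < s -> cvgn (pseries (hyp_coef s) y).
Proof.
move=> s0; apply: (@is_cvg_pseries_inside _ _ (`|y| + 1)); last first.
  by rewrite [ltRHS]ger0_norm ?addr_ge0 // ltrDl.
apply: (@series_le_cvg _ _ (fun k => (1 + (4 * s)^-1) * exp_coeff (`|y| + 1) k)) => [k|k|k|].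
- by rewrite mulr_ge0 // ?exprn_ge0 ?addr_ge0 // ltW // hyp_coef_gt0.
- by rewrite mulr_ge0 ?addr_ge0 ?invr_ge0 ?mulr_ge0 ?exp_coeff_ge0 ?addr_ge0 // ltW.
- rewrite /exp_coeff /= [X in _ <= _ * X]mulrC mulrA ler_wpM2r ?exprn_ge0 ?addr_ge0 //.
  exact: hyp_coef_le.
exact/is_cvg_seriesZ/is_cvg_series_exp_coeff.
Qed.

Lemma limn_hypZ c s y : 0 < s ->
  limn (pseries (fun k => c * hyp_coef s k) y) = c * hyp s y.
Proof.
move=> s0; apply: cvg_lim => //.
have -> : pseries (fun k => c * hyp_coef s k) y = (fun n => c * pseries (hyp_coef s) y n).
  apply/funext => n; rewrite /pseries /series /= mulr_sumr.
  by apply: eq_bigr => i _; rewrite mulrA.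
by apply: cvgM; [exact: cvg_cst|exact: is_cvg_hyp].
Qed.

Lemma is_cvg_hypZ c s y : 0 < s -> cvgn (pseries (fun k => c * hyp_coef s k) y).
Proof.
move=> s0; have := @is_cvg_seriesZ _ _ c (@is_cvg_hyp s y s0).
suff -> : c *: (fun i => hyp_coef s i * y ^+ i) = (fun i => c * hyp_coef s i * y ^+ i) by [].
by apply/funext => i; rewrite /= -mulrA.
Qed.

Lemma is_derive_hyp s y : 0 < s ->
  is_derive y (1 : R) (hyp s) ((4 * s)^-1 * hyp (s + 1) y).
Proof.
move=> s0; have s1 : 0 < s + 1 by rewrite addr_gt0.
have s2 : 0 < s + 1 + 1 by rewrite addr_gt0.
have := @pseries_snd_diffs _ (hyp_coef s) (`|y| + 1) y.
rewrite hyp_coef_diffs // -(@limn_hypZ _ _ y s1); apply.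
- exact: is_cvg_hyp.
- exact: is_cvg_hypZ.
- have -> : pseries_diffs (fun k => (4 * s)^-1 * hyp_coef (s + 1) k) =
     (fun k => (4 * s)^-1 * ((4 * (s + 1))^-1 * hyp_coef (s + 1 + 1) k)).
    have := hyp_coef_diffs s1; rewrite /pseries_diffs => E.
    by apply/funext => k; rewrite mulrCA; have /= -> := congr1 (fun f => f k) E.
  rewrite (_ : (fun k => _) = fun k => (4 * s)^-1 * (4 * (s + 1))^-1 * hyp_coef (s + 1 + 1) k).
    exact: is_cvg_hypZ.
  by apply/funext => k; rewrite mulrA.
- by rewrite [ltRHS]ger0_norm ?addr_ge0 // ltrDl.
Qed.

(** Bessel's recurrence between three consecutive orders, checked on coefficients. As
    differentiation raises [s] by one up to a factor, it amounts to the differential equation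
    [y F'' + s F' = F / 4] of [hyp_ode]. *)
Lemma hyp_contiguous s y : 0 < s ->
  hyp s y = hyp (s + 1) y + (4 * s * (s + 1))^-1 * y * hyp (s + 1 + 1) y.
Proof.
move=> s0; have s1 : 0 < s + 1 by rewrite addr_gt0.
have s2 : 0 < s + 1 + 1 by rewrite addr_gt0.
have cS k : hyp_coef s k.+1 =
    hyp_coef (s + 1) k.+1 + (4 * s * (s + 1))^-1 * hyp_coef (s + 1 + 1) k.
  have f0 : k`!%:R != 0 :> R by rewrite pnatr_eq0 -lt0n fact_gt0.
  have e0 : (4 : R) ^+ k != 0 by rewrite expf_neq0.
  have p0 : pochhammer (s + 1 + 1) k != 0 by rewrite gt_eqF // pochhammer_gt0.
  have sk : s + 1 + k%:R != 0 by rewrite gt_eqF // ltr_wpDr.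
  have E : pochhammer (s + 1) k = (s + 1) * pochhammer (s + 1 + 1) k / (s + 1 + k%:R).
    by rewrite -pochhammerSl pochhammerS mulfK.
  rewrite /hyp_coef pochhammerSl [pochhammer (s + 1) k.+1]pochhammerSl E exprS factS natrM.
  rewrite -[k.+1%:R]natr1; field.
  rewrite p0 f0 e0 (gt_eqF s0) (gt_eqF s1) sk /=.
  by rewrite natr1 pnatr_eq0.
apply: cvg_lim => //; rewrite -cvg_shiftS /=.
have c1 : pseries (hyp_coef (s + 1)) y n.+1 @[n --> \oo] --> hyp (s + 1) y.
  by rewrite (cvg_shiftS (pseries (hyp_coef (s + 1)) y)); exact: is_cvg_hyp.
have c2 : pseries (hyp_coef (s + 1 + 1)) y n @[n --> \oo] --> hyp (s + 1 + 1) y.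
  exact: is_cvg_hyp.
rewrite (_ : (fun n => _) = fun n => pseries (hyp_coef (s + 1)) y n.+1 +
    (4 * s * (s + 1))^-1 * y * pseries (hyp_coef (s + 1 + 1)) y n); last first.
  apply/funext => n; rewrite /pseries /series /=.
  rewrite !big_nat_recl //= !hyp_coef0 -addrA mulr_sumr -big_split /=.
  by congr (_ + _); apply: eq_bigr => i _; rewrite cS exprS; ring.
by apply: cvgD => //; apply: cvgM => //; exact: cvg_cst.
Qed.

Lemma hyp_ode s y : 0 < s ->
  y * ((4 * s)^-1 * ((4 * (s + 1))^-1 * hyp (s + 1 + 1) y)) +
  s * ((4 * s)^-1 * hyp (s + 1) y) = 4^-1 * hyp s y.
Proof.
move=> s0; rewrite [in RHS]hyp_contiguous //; field.
by rewrite !gt_eqF // addr_gt0.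
Qed.

Lemma hyp_ge1 s y : 0 < s -> 0 <= y -> 1 <= hyp s y.
Proof.
move=> s0 y0; apply: limr_ge; first exact: is_cvg_hyp.
exists 1%N => // -[//|n] _; rewrite /pseries /series /= big_nat_recl //= hyp_coef0 mul1r.
rewrite expr0 lerDl; apply: sumr_ge0 => i _.
by rewrite mulr_ge0 ?exprn_ge0 // ltW // hyp_coef_gt0.
Qed.

Lemma hyp_gt0 s y : 0 < s -> 0 <= y -> 0 < hyp s y.
Proof. by move=> s0 y0; rewrite (lt_le_trans ltr01) // hyp_ge1. Qed.

Lemma hyp0 s : hyp s 0 = 1.
Proof.
apply: cvg_lim => //; rewrite -cvg_shiftS /=.
rewrite (_ : (fun n => _) = fun=> 1); first exact: cvg_cst.
apply/funext => n; rewrite /pseries /series /= big_nat_recl //= hyp_coef0 expr0 mulr1.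
by rewrite big1 ?addr0 // => i _; rewrite expr0n mulr0.
Qed.

Lemma continuous_hyp s : 0 < s -> continuous (hyp s).
Proof.
move=> s0 y; apply: differentiable_continuous; apply/derivable1_diffP.
by have [] := is_derive_hyp y s0.
Qed.

(** For [s = 1 / 2] both sides agree, the series being that of cosh; larger [s] only increases the
    Pochhammer factors in the denominator. *)
Lemma hyp_coef_le_even_fact s k : 1 <= s -> hyp_coef s k <= (k.*2)`!%:R^-1.
Proof.
move=> s1; have s0 : 0 < s by rewrite (lt_le_trans ltr01).
rewrite /hyp_coef lef_pV2 ?posrE ?ltr0n ?fact_gt0 //; last first.
  by rewrite !mulr_gt0 ?exprn_gt0 ?ltr0n ?fact_gt0 // pochhammer_gt0.
elim: k => [|k IH].
  by rewrite fact0 expr0 /pochhammer big_ord0 !mulr1.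
rewrite doubleS !factS pochhammerS exprS mulnA natrM.
have -> : 4 * 4 ^+ k * (k.+1 * k`!)%:R * (pochhammer s k * (s + k%:R)) =
   4 * k.+1%:R * (s + k%:R) * (4 ^+ k * k`!%:R * pochhammer s k).
  by rewrite natrM; ring.
apply: ler_pM => //.
have -> : (k.*2.+2 * k.*2.+1)%:R = 4 * k.+1%:R * (k%:R + 2^-1) :> R.
  by rewrite natrM -[k.*2.+2]/(k.+1.*2) -muln2 natrM -[k.*2.+1%:R]natr1 -muln2 natrM; field.
rewrite ler_wpM2l // ?mulr_ge0 // addrC lerD2r (le_trans _ s1) //.
by rewrite invf_le1 // ler1n.
Qed.

Lemma hyp_le_expR s x : 1 <= s -> 0 <= x -> hyp s (x ^+ 2) <= expR x.
Proof.
move=> s1 x0; have s0 : 0 < s by rewrite (lt_le_trans ltr01).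
apply: limr_le; first exact: is_cvg_hyp.
apply: nearW => n.
apply: (@le_trans _ _ (series (exp_coeff x) n.*2)).
  rewrite /pseries /series /=; elim: n => [|n IH]; first by rewrite !big_geq.
  rewrite doubleS !big_nat_recr //= -addrA lerD //.
  rewrite -[leLHS]addr0 lerD ?exp_coeff_ge0 //.
  rewrite /exp_coeff /= -exprM mul2n mulrC ler_wpM2l ?exprn_ge0 //.
  exact: hyp_coef_le_even_fact.
apply: nondecreasing_cvgn_le; last exact: is_cvg_series_exp_coeff.
by apply: nondecreasing_series => i _ _; exact: exp_coeff_ge0.
Qed.

End HypergeometricSeries.

(** * The Gamma function *)

Section GammaFunction.
Variable R : realType.
Implicit Types (s t : R).
Notation mu := (@lebesgue_measure R).

Definition gamma_int s t : R := t `^ (s - 1) * expR (- t).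

(** Kept in the extended reals so that the recurrence can be proved before finiteness, which is then
    deduced from it. *)
Definition egamma s : \bar R := (\int[mu]_(t in `]0%R, +oo[) (gamma_int s t)%:E)%E.

Let lo n : R := n.+2%:R^-1.
Let hi n : R := n.+2%:R.

Lemma gamma_int_ge0 s t : 0 <= gamma_int s t.
Proof. by rewrite mulr_ge0 ?powR_ge0 ?expR_ge0. Qed.

Lemma is_derive_gamma_int s t : 0 < t ->
  is_derive t (1 : R) (fun u => - (u `^ s * expR (- u))) (gamma_int (s + 1) t - s * gamma_int s t).
Proof.
move=> t0; rewrite /gamma_int addrK.
have dE : is_derive t (1 : R) (fun u : R => expR (- u)) (- expR (- t)).
  by rewrite -mulrN1; apply: is_derive1_compE (is_derive_expR _) (is_deriveNid t 1).
apply: (@is_derive_eq _ _ _ _ _ _ _ _ (is_derive1N (is_derive1M (is_derive1_powR s t0) dE))).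
ring.
Qed.

Lemma continuous_gamma_int s t : 0 < t -> {for t, continuous (gamma_int s)}.
Proof.
move=> t0; apply: differentiable_continuous; apply/derivable1_diffP.
have := is_derive_gamma_int (s - 1) t0.
by rewrite -[X in _ -> derivable X _ _]opprK => -[/derivableN].
Qed.

Lemma within_continuous_gamma_int s a b : 0 < a -> {within `[a, b], continuous (gamma_int s)}.
Proof.
move=> a0; apply: continuous_in_subspaceT => t; rewrite inE /= in_itv /= => /andP[at_ _].
by apply: continuous_gamma_int; apply: lt_le_trans at_.
Qed.

Lemma integrable_gamma_int s a b : 0 < a -> mu.-integrable `[a, b] (EFin \o gamma_int s).
Proof.
move=> a0; apply: continuous_compact_integrable; first exact: segment_compact.
exact: within_continuous_gamma_int.
Qed.

Let partial s n := \int[mu]_(t in `[lo n, hi n]) gamma_int s t.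

Let lo_gt0 n : 0 < lo n.
Proof. by rewrite invr_gt0. Qed.

Let lohi n : lo n < hi n.
Proof. by rewrite (@lt_trans _ _ 1) // ?invf_lt1 ?ltr1n. Qed.

Lemma partial_gammaS s n :
  partial (s + 1) n = s * partial s n + (lo n `^ s * expR (- lo n) - hi n `^ s * expR (- hi n)).
Proof.
have dF t : 0 < t -> derivable (fun u : R => - (u `^ s * expR (- u))) t 1.
  by move=> t0; have [] := is_derive_gamma_int s t0.
have cF t : 0 < t -> {for t, continuous (fun u : R => - (u `^ s * expR (- u)))}.
  by move=> t0; apply: differentiable_continuous; apply/derivable1_diffP/dF.
have in0 t : t \in `]lo n, hi n[ -> 0 < t.
  by rewrite in_itv /= => /andP[+ _]; apply: lt_trans.
have := @continuous_FTC2 _ (fun t => gamma_int (s + 1) t - s * gamma_int s t)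
  (fun u => - (u `^ s * expR (- u))) (lo n) (hi n) (lohi n).
move=> /(_ _ _ _)/(congr1 fine); rewrite -[LHS]/(Rintegral _ _ _) => E.
have {E} : \int[mu]_(t in `[lo n, hi n]) (gamma_int (s + 1) t - s * gamma_int s t) =
   - (hi n `^ s * expR (- hi n)) + lo n `^ s * expR (- lo n).
  rewrite E /= ?opprK //.
  - move=> t; apply: cvgB; first exact: within_continuous_gamma_int.
    by apply: cvgM; [exact: cvg_cst|exact: within_continuous_gamma_int].
  - split => [t /in0 /dF //||].
    + by apply: cvg_at_right_filter; exact: cF.
    + by apply: cvg_at_left_filter; apply: cF; exact: lt_trans (lohi n).
  - by move=> t /in0 t0; rewrite derive1E; have [] := is_derive_gamma_int s t0.
rewrite RintegralB //; last 2 first.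
- exact: integrable_gamma_int.
- apply: continuous_compact_integrable; first exact: segment_compact.
  by move=> t; apply: cvgM; [exact: cvg_cst|exact: within_continuous_gamma_int].
rewrite RintegralZl //; last exact: integrable_gamma_int.
by rewrite -/(partial _ _) -/(partial _ _) => /eqP; rewrite subr_eq => /eqP ->; ring.
Qed.

Lemma cvg_partial_gamma s : (partial s n)%:E @[n --> \oo] --> egamma s.
Proof.
have m0y : measurable_fun (`]0, +oo[ : set R) (gamma_int s).
  apply: open_continuous_measurable_fun => // t; rewrite inE /= in_itv /= andbT.
  exact: continuous_gamma_int.
have E : (`]0, +oo[%classic : set R) = \bigcup_n `[lo n, hi n]%classic.
  apply/seteqP; split => t /=; last first.
    by move=> [n _] /=; rewrite !in_itv /= andbT => /andP[+ _]; apply: lt_le_trans.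
  rewrite in_itv /= andbT => t0.
  exists (maxn (Num.truncn t^-1) (Num.truncn t)) => //=; rewrite in_itv /=; apply/andP; split.
    rewrite -[leRHS]invrK lef_pV2 ?posrE ?invr_gt0 // (le_trans (ltW (truncnS_gt _))) //.
    by rewrite ler_nat ltnS (leq_trans (leq_maxl _ (Num.truncn t))) // leqnSn.
  rewrite (le_trans (ltW (truncnS_gt _))) // ler_nat ltnS.
  by rewrite (leq_trans (leq_maxr (Num.truncn t^-1) _)) // leqnSn.
rewrite (_ : (fun n => _) = fun n => (\int[mu]_(t in `[lo n, hi n]) (gamma_int s t)%:E)%E); last first.
  apply/funext => n; rewrite fineK //; apply: integrable_fin_num => //.
  exact: integrable_gamma_int.
rewrite /egamma E; apply: ge0_nondecreasing_set_cvg_integral => //.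
- apply/nondecreasing_seqP => n; apply/subsetPset/subset_itv; rewrite bnd_simp.
    by rewrite lef_pV2 ?posrE // ler_nat.
  by rewrite ler_nat.
- move=> n; apply/measurable_EFinP; apply: measurable_funS m0y => //.
  by move=> t /=; rewrite !in_itv /= andbT => /andP[+ _]; apply: lt_le_trans.
- by move=> n t _; rewrite lee_fin gamma_int_ge0.
Qed.

Let cvg_lo : lo n @[n --> \oo] --> (0 : R)^'+.
Proof.
move=> A [e /= e0 eA]; exists (Num.truncn e^-1) => // n /= en.
apply: eA => //=; rewrite sub0r normrN gtr0_norm //.
rewrite -[ltRHS]invrK ltf_pV2 ?posrE ?invr_gt0 // (lt_le_trans (truncnS_gt _)) //.
by rewrite ler_nat ltnS (leq_trans en) // leqnSn.
Qed.

Lemma cvg_gamma_boundary s : 0 < s ->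
  lo n `^ s * expR (- lo n) - hi n `^ s * expR (- hi n) @[n --> \oo] --> 0.
Proof.
move=> s0; rewrite -[X in _ --> X]subr0; apply: cvgB.
  apply: (@squeeze_cvgr _ _ _ _ (fun=> 0) (fun n => lo n `^ s)).
  - apply: nearW => n; rewrite mulr_ge0 ?powR_ge0 ?expR_ge0 //=.
    by rewrite ler_piMr ?powR_ge0 // -expR0 ler_expR oppr_le0 ltW.
  - exact: cvg_cst.
  - apply: (@cvg_comp _ _ _ lo (fun a => a `^ s) _ (0 : R)^'+); last exact: powR_cvg0.
    apply: cvg_lo.
(* As [s < m + 1], the power is at most [hi ^ (m + 1)], while the exponential exceeds
   [hi ^ (m + 2) / (m + 2)!]; a factor [1 / hi = lo] remains. *)
pose m := Num.truncn s.
apply: (@squeeze_cvgr _ _ _ _ (fun=> 0) (fun n => m.+2`!%:R * lo n)).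
- apply: nearW => n; rewrite mulr_ge0 ?powR_ge0 ?expR_ge0 //=.
  have h1 : 1 <= hi n by rewrite ler1n.
  have e0 := expR_gt0 (hi n).
  rewrite expRN ler_pdivrMr // mulrAC ler_pdivlMr ?ltr0n //.
  have : hi n `^ s <= hi n ^+ m.+1.
    by rewrite -powR_mulrn ?(le_trans ler01) // ler_powR // ltW // truncnS_gt.
  move=> /(ler_wpM2r (le_trans ler01 h1))/le_trans; apply.
  rewrite -exprSr mulrC -ler_pdivrMr ?ltr0n ?fact_gt0 //.
  by apply: le_trans (expR_ge1Dxn m.+1 (le_trans ler01 h1)); rewrite lerDr.
- exact: cvg_cst.
- rewrite -[X in _ --> X](mulr0 (m.+2`!%:R)); apply: cvgM; first exact: cvg_cst.
  by apply: cvg_trans cvg_lo _; exact: cvg_within.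
Qed.

Lemma egamma_recurrence s : 0 < s -> egamma (s + 1) = (s%:E * egamma s)%E.
Proof.
move=> s0; rewrite -(cvg_lim _ (@cvg_partial_gamma (s + 1))) //; apply: cvg_lim => //.
rewrite (_ : (fun n => _) = fun n => (s%:E * (partial s n)%:E +
   (lo n `^ s * expR (- lo n) - hi n `^ s * expR (- hi n))%:E)%E); last first.
  by apply/funext => n; rewrite partial_gammaS.
rewrite -[X in _ --> X]adde0; apply: cvgeD => //.
- by rewrite fin_num_adde_defl.
- apply: cvgeZl => //; exact: cvg_partial_gamma.
- by apply: cvg_EFin; [exact: nearW|exact: cvg_gamma_boundary].
Qed.

Lemma egamma_ge0 s : (0 <= egamma s)%E.
Proof. by apply: integral_ge0 => t _; rewrite lee_fin gamma_int_ge0. Qed.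

Let measurable_gamma_int s : measurable_fun (`]0, +oo[ : set R) (EFin \o gamma_int s).
Proof.
apply/measurable_EFinP; apply: open_continuous_measurable_fun => // t.
by rewrite inE /= in_itv /= andbT; exact: continuous_gamma_int.
Qed.

Lemma egamma1 : egamma 1 = 1%E.
Proof.
rewrite /egamma integral_itv_obnd_cbnd; last exact: measurable_gamma_int.
rewrite -(@integral_exponential_pdf R 1 ltr01) [LHS]integral_mkcond.
apply: eq_integral => t _; rewrite /exponential_pdf !patchE; case: ifPn => // t0.
by rewrite /gamma_int /= subrr powRr0 !mul1r mulN1r.
Qed.

Lemma egamma_nat n : egamma n.+1%:R = (n`!%:R)%:E.
Proof.
elim: n => [|n IH]; first by rewrite egamma1 fact0.
by rewrite -natr1 egamma_recurrence // IH factS natrM.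
Qed.

(** By the recurrence it suffices to bound [egamma (s + 1)], where [t ^ s <= 1 + t ^ (m + 1)]
    reduces to values at positive integers. *)
Lemma egamma_fin_num s : 0 < s -> egamma s \is a fin_num.
Proof.
move=> s0; rewrite ge0_fin_numE ?egamma_ge0 //.
suff : (egamma (s + 1) < +oo)%E.
  rewrite egamma_recurrence // !ltey; apply: contraNneq => ->.
  by rewrite gt0_muley ?lte_fin.
pose m := Num.truncn s.
apply: (@le_lt_trans _ _ (egamma 1 + egamma m.+2%:R)%E); last first.
  by rewrite egamma1 egamma_nat ltry.
rewrite -ge0_integralD //=; last 4 first.
- by move=> t _; rewrite lee_fin gamma_int_ge0.
- exact: measurable_gamma_int.
- by move=> t _; rewrite lee_fin gamma_int_ge0.
- exact: measurable_gamma_int.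
apply: ge0_le_integral => //=.
- by move=> t _; rewrite lee_fin gamma_int_ge0.
- exact: measurable_gamma_int.
- by apply: emeasurable_funD; exact: measurable_gamma_int.
move=> t; rewrite in_itv /= andbT => t0.
rewrite -EFinD lee_fin /gamma_int -mulrDl ler_wpM2r ?expR_ge0 // addrK subrr powRr0.
have -> : m.+2%:R - 1 = m.+1%:R :> R by rewrite -[m.+2%:R]natr1 addrK.
have [t1|t1] := leP t 1.
  rewrite ler_wpDr ?powR_ge0 //.
  by rewrite -(powRr0 t) ger_powR ?t0 // ltW.
by rewrite ler_wpDl // ler_powR ?ltW // truncnS_gt.
Qed.

Lemma egamma_gt0 s : 0 < s -> (0 < egamma s)%E.
Proof.
(* [c] is the value of [t ^ (-1) * expR (- t)] at 2; it bounds the integrand from below on [1, 2],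
   since [s - 1 > -1] and [t >= 1]. *)
move=> s0; pose c : R := 2^-1 * expR (- 2).
have c0 : 0 < c by rewrite mulr_gt0 ?expR_gt0.
have sub : `[1, 2]%classic `<=` (`]0, +oo[%classic : set R).
  by move=> t /=; rewrite !in_itv /= andbT => /andP[+ _]; apply: lt_le_trans.
apply: (@lt_le_trans _ _ (\int[mu]_(t in `[1%R, 2%R]) (cst c%:E t))%E).
  by rewrite integral_cst //= lebesgue_measure_itv /= lte_fin ltr1n -EFinB -EFinM lte_fin mulr_gt0 // subr_gt0 ltr1n.
apply: le_trans (_ : (\int[mu]_(t in `[1%R, 2%R]) (gamma_int s t)%:E <= _)%E); last first.
  apply: ge0_subset_integral => //; first exact: measurable_gamma_int.
  by move=> t _; rewrite lee_fin gamma_int_ge0.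
apply: ge0_le_integral => //=.
- by move=> t _; rewrite lee_fin ltW.
- by apply: measurable_funS (measurable_gamma_int s).
move=> t; rewrite in_itv /= => /andP[t1 t2]; rewrite lee_fin.
have t0 : 0 < t by rewrite (lt_le_trans ltr01).
apply: ler_pM => //; rewrite ?expR_ge0 // ?ler_expR ?lerN2 //.
apply: (@le_trans _ _ (t `^ (-1))); last by rewrite ler_powR // lerBrDl subrr ltW.
by rewrite powR_inv1 ?lef_pV2 ?posrE // ltW.
Qed.

Lemma GammaE s : Gamma s = fine (egamma s).
Proof. by []. Qed.

Lemma GammaD1 s : 0 < s -> Gamma (s + 1) = s * Gamma s.
Proof. by move=> s0; rewrite !GammaE egamma_recurrence // fineM // egamma_fin_num. Qed.

Lemma Gamma_gt0 s : 0 < s -> 0 < Gamma s.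
Proof. by move=> s0; rewrite GammaE fine_gt0 // egamma_gt0 // ltey_eq egamma_fin_num. Qed.

Lemma Gamma_pochhammer s k : 0 < s -> Gamma (k%:R + s) = pochhammer s k * Gamma s.
Proof.
move=> s0; elim: k => [|k IH]; first by rewrite /pochhammer big_ord0 mul1r add0r.
rewrite -natr1 -addrA [1 + s]addrC addrA GammaD1 ?ltr_wpDl // IH pochhammerS.
by rewrite [k%:R + s]addrC; ring.
Qed.

End GammaFunction.

(** * Monotonicity of Bessel quotients *)

Section BesselMonotone.
Variable R : realType.
Implicit Types (s x y z : R).

(* [z^k p(z)] is nondecreasing and vanishes at [0]. *)
Lemma nonneg_euler_ode (k : R) (p p' : R -> R) : 0 < k ->
  (forall t : R, 0 <= t <= 1 -> is_derive t (1 : R) p (p' t)) ->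
  (forall t : R, 0 <= t <= 1 -> 0 <= t * p' t + k * p t) ->
  forall t : R, 0 <= t <= 1 -> 0 <= p t.
Proof.
move=> k0 dp p0 t /andP[]; rewrite le_eqVlt => /orP[/eqP <- _|t0 t1].
  have := p0 0; rewrite lexx ler01 mul0r add0r => /(_ isT).
  by rewrite pmulr_rge0.
rewrite -(pmulr_rge0 _ (powR_gt0 k t0)).
have c0 : e `^ k * p e @[e --> (0 : R)^'+] --> 0 * p 0.
  apply: cvgM; first exact: powR_cvg0.
  apply: cvg_at_right_filter; apply: differentiable_continuous.
  apply/derivable1_diffP; have [|//] := dp 0.
  by rewrite lexx ler01.
rewrite mul0r in c0; apply: (cvgr_to_le c0).
near=> e; have e0 : 0 < e by [].
apply: (@is_derive_le _ e t (fun u => u `^ k * p u)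
  (fun u => k * u `^ (k - 1) * p u + u `^ k * p' u)).
- by near: e; exact: nbhs_right_le.
- move=> u /andP[eu ut]; have u0 : 0 < u by apply: lt_le_trans eu.
  apply: is_derive1M; first exact: is_derive1_powR.
  by apply: dp; rewrite (ltW u0) (le_trans ut).
- move=> u /andP[eu ut]; have u0 : 0 < u by apply: lt_le_trans eu.
  rewrite -(mulr_powRB1 (ltW u0) k0).
  have -> : k * u `^ (k - 1) * p u + u * u `^ (k - 1) * p' u =
     u `^ (k - 1) * (u * p' u + k * p u) by ring.
  by rewrite mulr_ge0 ?powR_ge0 // p0 // (ltW u0) (le_trans ut).
Unshelve. all: end_near. Qed.

Definition hyp' s y : R := (4 * s)^-1 * hyp (s + 1) y.
Definition hyp'' s y : R := (4 * s)^-1 * hyp' (s + 1) y.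

Lemma is_derive_hyp' s y : 0 < s -> is_derive y (1 : R) (hyp' s) (hyp'' s y).
Proof. by move=> s0; apply: is_derive1Z; apply: is_derive_hyp; rewrite addr_gt0. Qed.

Lemma hyp_ode' s y : 0 < s -> y * hyp'' s y = 4^-1 * hyp s y - s * hyp' s y.
Proof. by move=> s0; rewrite -hyp_ode // /hyp'' /hyp'; ring. Qed.

Section Quotient.
Variables (s : R) (s0 : 0 < s).

Let L z x := hyp s (z * x) / hyp s x.
Let L' z x := x * hyp' s (z * x) / hyp s x.
Let L'' z x := x * (x * hyp'' s (z * x)) / hyp s x.

Let dL z x : is_derive z (1 : R) (L ^~ x) (L' z x).
Proof.
rewrite /L /L' mulrC; have H := is_derive1_scale (is_derive_hyp (z * x) s0).
under eq_fun do rewrite mulrC.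
exact: is_derive1Z H.
Qed.

Let dL' z x : is_derive z (1 : R) (L' ^~ x) (L'' z x).
Proof.
rewrite /L' /L'' mulrAC; have H := is_derive1_scale (is_derive_hyp' (z * x) s0).
under eq_fun do rewrite mulrAC.
exact: is_derive1Z H.
Qed.

Let L_ode z x : 0 < x -> z * L'' z x + s * L' z x = x * (4^-1 * L z x).
Proof.
move=> x0; rewrite /L /L' /L''.
have -> : z * (x * (x * hyp'' s (z * x)) / hyp s x) = x * (z * x * hyp'' s (z * x)) / hyp s x.
  by field; rewrite gt_eqF // hyp_gt0 // ltW.
by rewrite hyp_ode' //; field; rewrite gt_eqF // hyp_gt0 // ltW.
Qed.

(** The unnormalised solution of the same equation, positive for nonnegative arguments: the partner
    of the differences of [L] in the Wronskian. *)
Let G z x := hyp s (z * x).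
Let G' z x := x * hyp' s (z * x).
Let G'' z x := x * (x * hyp'' s (z * x)).

Let dG z x : is_derive z (1 : R) (G ^~ x) (G' z x).
Proof. exact: (is_derive1_scale (is_derive_hyp (z * x) s0)). Qed.

Let dG' z x : is_derive z (1 : R) (G' ^~ x) (G'' z x).
Proof. exact: is_derive1Z (is_derive1_scale (is_derive_hyp' (z * x) s0)). Qed.

Let G_ode z x : z * G'' z x + s * G' z x = 4^-1 * x * G z x.
Proof.
rewrite /G /G' /G''.
have -> : z * (x * (x * hyp'' s (z * x))) = x * (z * x * hyp'' s (z * x)) by ring.
by rewrite hyp_ode' //; ring.
Qed.

Let v n h z x := iter n (diff h) (L z) x.
Let v' n h z x := iter n (diff h) (L' z) x.

(* The negated Wronskian [p] satisfies [z p' + s p >= 0], because differencing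
   [L_ode] in [x] only adds the source [- n h v_(n-1) / 4]. *)
Lemma hyp_wronskian_le0 n h x : 0 < h -> 0 < x ->
  (forall y z, 0 < y -> 0 <= z <= 1 -> 0 <= v n h z y) ->
  forall z, 0 <= z <= 1 -> v' n.+1 h z x * G z x - v n.+1 h z x * G' z x <= 0.
Proof.
move=> h0 x0 v0 z z01; rewrite -oppr_ge0.
pose v'' z := iter n.+1 (diff h) (L'' z) x.
have dv t : is_derive t (1 : R) (fun z => v n.+1 h z x) (v' n.+1 h t x).
  by apply: is_derive_iter_diff.
have dv' t : is_derive t (1 : R) (fun z => v' n.+1 h z x) (v'' t).
  by apply: is_derive_iter_diff.
have v_ode t : t * v'' t + s * v' n.+1 h t x =
    x * (4^-1 * v n.+1 h t x) - n.+1%:R * h * (4^-1 * v n h t (x + h)).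
  rewrite -iter_diffZ -iter_diffZ -iter_diffD.
  rewrite (@eq_iter_diff _ _ _ _ (fun y => y * (4^-1 * L t y))) //; last first.
    by move=> y xy; apply: L_ode; apply: lt_le_trans xy.
  by rewrite iter_diffX !iter_diffZ.
apply: (@nonneg_euler_ode s (fun z => - (v' n.+1 h z x * G z x - v n.+1 h z x * G' z x))
  (fun z => - (v'' z * G z x - v n.+1 h z x * G'' z x))) => // t t01.
  apply: is_derive1N.
  apply: (@is_derive_eq _ _ _ _ _ _ _ _
    (is_derive1B (is_derive1M (dv' t) (dG t x)) (is_derive1M (dv t) (dG' t x)))).
  ring.
have -> : t * - (v'' t * G t x - v n.+1 h t x * G'' t x) +
    s * - (v' n.+1 h t x * G t x - v n.+1 h t x * G' t x) =
    - ((t * v'' t + s * v' n.+1 h t x) * G t x) +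
     v n.+1 h t x * (t * G'' t x + s * G' t x) by ring.
rewrite v_ode G_ode.
have -> : - ((x * (4^-1 * v n.+1 h t x) - n.+1%:R * h * (4^-1 * v n h t (x + h))) * G t x) +
  v n.+1 h t x * (4^-1 * x * G t x) = n.+1%:R * h * (4^-1 * v n h t (x + h)) * G t x by ring.
have G0 : 0 <= G t x.
  by case/andP: t01 => t0 _; rewrite ltW // hyp_gt0 // mulr_ge0 // ltW.
by rewrite !mulr_ge0 ?invr_ge0 // ?(ltW h0) // v0 // addr_gt0.
Qed.

Let v1 n h x : 0 < h -> 0 < x -> v n.+1 h 1 x = 0.
Proof.
move=> h0 x0; rewrite /v (@eq_iter_diff _ _ _ _ (fun=> 1)) ?iter_diff_cst // => y xy.
have y0 : 0 < y := lt_le_trans x0 xy.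
by rewrite /L mul1r divff // gt_eqF // hyp_gt0 // ltW.
Qed.

(** Induction on [n]: the nonpositive Wronskian makes [v / G] nonincreasing in [z], and differences
    of positive order vanish at [z = 1], where the quotient is constantly 1. *)
Lemma cmono_hyp_ratio z : 0 <= z <= 1 -> cmono (fun x => hyp s (z * x) / hyp s x).
Proof.
move=> z01 n h x h0 x0; rewrite -[_ _ x]/(v n h z x).
elim: n x z x0 z01 => [|n IH] x z x0 z01.
  by case/andP: z01 => z0 _; rewrite divr_ge0 // ltW // hyp_gt0 ?mulr_ge0 // ltW.
have G0 t : 0 <= t -> 0 < G t x.
  by move=> t0; rewrite hyp_gt0 // mulr_ge0 // ltW.
have /andP[z0 z1] := z01.
suff : - (v n.+1 h z x / G z x) <= - (v n.+1 h 1 x / G 1 x).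
  rewrite lerN2 v1 // mul0r => H; have := mulr_ge0 (ltW (G0 z z0)) H.
  by rewrite mulrCA divff ?mulr1 // gt_eqF // G0.
apply: (@is_derive_le _ z 1 (fun t => - (v n.+1 h t x / G t x))
  (fun t => - ((v' n.+1 h t x * G t x - v n.+1 h t x * G' t x) * G t x ^- 2))) => //.
  move=> t /andP[zt t1]; apply: is_derive1N.
  have Gt : G t x != 0 by rewrite gt_eqF // G0 // (le_trans z0).
  have dv : is_derive t (1 : R) (fun z => v n.+1 h z x) (v' n.+1 h t x).
    by apply: is_derive_iter_diff.
  exact: is_derive1_div.
move=> t /andP[zt t1]; rewrite -mulNr mulr_ge0 ?oppr_ge0 //.
  apply: hyp_wronskian_le0 => //.
  by rewrite t1 (le_trans z0).
by rewrite invr_ge0 exprn_ge0 // ltW // G0 // (le_trans z0).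
Qed.

(** At [z = 1] the difference [v] vanishes, so the Wronskian reduces to [v' * G], and [v'] is the
    difference of the logarithmic derivative [L' 1]. *)
Lemma bernstein_hyp_logderiv : bernstein (fun x => x * hyp' s x / hyp s x).
Proof.
move=> n h x h0 x0.
have := @hyp_wronskian_le0 n h x h0 x0 _ 1.
rewrite ler01 lexx v1 // mul0r subr0 => H.
have {H} : v' n.+1 h 1 x * G 1 x <= 0.
  by apply: H => // y z y0 z01; exact: cmono_hyp_ratio.
rewrite pmulr_lle0; last by rewrite hyp_gt0 // mul1r ltW.
rewrite /v'; congr (_ <= 0).
by apply: eq_iter_diff => // y _; rewrite /L' mul1r.
Qed.

End Quotient.

End BesselMonotone.

(** * Bernstein functions from logarithms of Bessel functions *)

Section BesselExponents.
Variable R : realType.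
Implicit Types (s x y z c : R).

Lemma cmono_powRN c p : 0 <= c -> 0 < p -> cmono (fun x : R => c * x `^ (- p)).
Proof.
move=> c0 p0; pose f k x : R := c * pochhammer p k * x `^ (- p - k%:R).
apply: (@cmono_ext _ (f 0%N)).
  by move=> x x0; rewrite /f /pochhammer big_ord0 mulr1 subr0.
apply: cmono_derive => k x x0; first by rewrite !mulr_ge0 ?powR_ge0 // ltW // pochhammer_gt0.
apply: (@is_derive_eq _ _ _ _ _ _ _ _ (is_derive1Z _ (is_derive1_powR (- p - k%:R) x0))).
rewrite /f pochhammerS -[k.+1%:R]natr1.
have -> : - p - (k%:R + 1) = - p - k%:R - 1 by ring.
ring.
Qed.

Lemma sqrt_derivE x : 0 < x -> (2 * Num.sqrt x)^-1 = 2^-1 * x `^ (- 2^-1).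
Proof. by move=> x0; rewrite powRN powR12_sqrt ?ltW // invfM. Qed.

Lemma bernstein_sqrt : bernstein (@Num.sqrt R).
Proof.
apply: (@bernstein_derive _ _ (fun x => 2^-1 * x `^ (- 2^-1))); last exact: cmono_powRN.
by move=> x x0; rewrite -sqrt_derivE //; exact: is_derive1_sqrt.
Qed.

(** The derivative of [ln (hyp s (t * x))] in the scale [t] is [1 / t] times the Bernstein function
    of [bernstein_hyp_logderiv] taken at [t * x]. *)
Lemma bernstein_ln_hyp_ratio s a b : 0 < s -> 0 < a -> a <= b ->
  bernstein (fun x => ln (hyp s (b * x)) - ln (hyp s (a * x))).
Proof.
move=> s0 a0 ab.
apply: (@bernstein_increment _ a b (fun t x => ln (hyp s (t * x)))
  (fun t x => t^-1 * (t * x * hyp' s (t * x) / hyp s (t * x)))) => //.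
  move=> t x /andP[at_ _] x0; have t0 : 0 < t := lt_le_trans a0 at_.
  have h0 : 0 < hyp s (t * x) by rewrite hyp_gt0 // mulr_ge0 // ltW.
  apply: (@is_derive_eq _ _ _ _ _ _ _ _ (@is_derive1_compE _ _ (fun t => hyp s (t * x)) _ _ _ (is_derive1_ln h0)
    (is_derive1_scale (is_derive_hyp (t * x) s0)))).
  by rewrite /hyp'; field; rewrite !gt_eqF.
move=> t /andP[at_ _]; have t0 : 0 < t := lt_le_trans a0 at_.
apply: bernsteinZ; first by rewrite invr_ge0 ltW.
exact: (bernstein_scale t0 (bernstein_hyp_logderiv s0)).
Qed.

Section LargeOrder.
Variables (s : R) (s32 : 3 / 2 < s).

Let s0 : 0 < s. Proof. by move: s32; lra. Qed.

Let A t x : R := (s - 2^-1) * hyp s (t * t * x) + 2 * (t * t * x) * hyp' s (t * t * x)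
   - Num.sqrt x * t * hyp s (t * t * x).
Let A' t x : R := (s - 2^-1) * (2 * t * x * hyp' s (t * t * x)) +
   (4 * t * x * hyp' s (t * t * x) + 2 * (t * t * x) * (2 * t * x * hyp'' s (t * t * x)))
   - (Num.sqrt x * hyp s (t * t * x) + Num.sqrt x * t * (2 * t * x * hyp' s (t * t * x))).

(* Up to the factor [t^(s - 3/2)], [q t x] is the Wronskian of [t^(s - 1/2) F(t^2 x)]
   and [exp(t sqrt x)], divided by their values at [t = 1]. *)
Let q t x : R := expR (- ((1 - t) * Num.sqrt x)) * A t x / hyp s x.
Let q' t x : R := expR (- ((1 - t) * Num.sqrt x)) * (A' t x + Num.sqrt x * A t x) / hyp s x.

Let dsq t x : is_derive t (1 : R) (fun t : R => t * t * x) (2 * t * x).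
Proof.
apply: (@is_derive_eq _ _ _ _ _ _ _ _ (is_derive1M
  (is_derive1M (is_derive_id t 1) (is_derive_id t 1)) (is_derive_cst x t 1))).
rewrite /=; ring.
Qed.

Let dhyp t x : is_derive t (1 : R) (fun t => hyp s (t * t * x)) (2 * t * x * hyp' s (t * t * x)).
Proof. by rewrite mulrC; exact: is_derive1_compE (is_derive_hyp _ s0) (dsq t x). Qed.

Let dhyp' t x : is_derive t (1 : R) (fun t => hyp' s (t * t * x)) (2 * t * x * hyp'' s (t * t * x)).
Proof. by rewrite mulrC; exact: is_derive1_compE (is_derive_hyp' _ s0) (dsq t x). Qed.

Let dA t x : is_derive t (1 : R) (A ^~ x) (A' t x).
Proof.
apply: (@is_derive_eq _ _ _ _ _ _ _ _ (is_derive1B (is_derive1D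
  (is_derive1Z (s - 2^-1) (dhyp t x)) (is_derive1M (is_derive1Z 2 (dsq t x)) (dhyp' t x)))
  (is_derive1M (is_derive1Z (Num.sqrt x) (is_derive_id t 1)) (dhyp t x)))).
rewrite /A' /=; ring.
Qed.

Let dq t x : is_derive t (1 : R) (q ^~ x) (q' t x).
Proof.
have dlin : is_derive t (1 : R) (fun t : R => - ((1 - t) * Num.sqrt x)) (Num.sqrt x).
  apply: (@is_derive_eq _ _ _ _ _ _ _ _ (is_derive1N (is_derive1M
    (is_derive1B (is_derive_cst (1 : R) t 1) (is_derive_id t 1)) (is_derive_cst (Num.sqrt x) t 1)))).
  rewrite /=; ring.
apply: (@is_derive_eq _ _ _ _ _ _ _ _ (is_derive1M (is_derive1M
  (is_derive1_compE (is_derive_expR _) dlin) (dA t x)) (is_derive_cst (hyp s x)^-1 t 1))).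
rewrite /q' /=; ring.
Qed.

(** With [s = nu + 1] the constant is [nu ^ 2 - 1 / 4 > 0]; for [t] in [0, 1] the right-hand side is
    therefore completely monotone in [x]. *)
Let q_ode t x : 0 < x -> t * q' t x + (s - 3 / 2) * q t x =
  (s - 3 / 2) * (s - 2^-1) *
    (expR (- ((1 - t) * Num.sqrt x)) * (hyp s (t * t * x) / hyp s x)).
Proof.
move=> x0; rewrite /q' /q.
suff E : t * (A' t x + Num.sqrt x * A t x) + (s - 3 / 2) * A t x =
    (s - 3 / 2) * (s - 2^-1) * hyp s (t * t * x).
  have -> : (s - 3 / 2) * (s - 2^-1) * (expR (- ((1 - t) * Num.sqrt x)) *
    (hyp s (t * t * x) / hyp s x)) = expR (- ((1 - t) * Num.sqrt x)) *
    ((s - 3 / 2) * (s - 2^-1) * hyp s (t * t * x)) / hyp s x by ring.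
  by rewrite -E; ring.
have r2 : Num.sqrt x * Num.sqrt x = x by rewrite -expr2 sqr_sqrtr // ltW.
rewrite /A' /A; have := hyp_ode' (t * t * x) s0.
set F := hyp s _; set F' := hyp' s _; set F'' := hyp'' s _; set r := Num.sqrt x.
move=> E.
(* Regrouped so that [F''] appears only as [t * t * x * F''], which [E] eliminates, and [r * r] can
   be replaced by [x]. *)
transitivity (4 * (t * t * x) * (t * t * x * F'') + 
  ((s - 2^-1) * (2 * (t * t * x) * F') + 4 * (t * t * x) * F' - r * t * F
   - r * t * (2 * (t * t * x) * F') + r * t * ((s - 2^-1) * F + 2 * (t * t * x) * F')
   - r * r * t * t * F +
   (s - 3 / 2) * ((s - 2^-1) * F + 2 * (t * t * x) * F' - r * t * F))); first by ring.
by rewrite E r2; field.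
Qed.

(** Differencing [q_ode] in [x] leaves an equation of Euler type with nonnegative right-hand side,
    so [nonneg_euler_ode] makes [q 1] completely monotone; and [q 1] is [s - 1 / 2] minus the
    function in question. *)
Lemma bernstein_sqrt_sub_logderiv :
  bernstein (fun x => Num.sqrt x - 2 * (x * hyp' s x / hyp s x)).
Proof.
suff cq : cmono (q 1).
  apply: bernstein_ext (bernstein_cstB (s - 2^-1) cq) => x x0.
  rewrite /q /A subrr mul0r oppr0 expR0 !mul1r.
  by field; rewrite gt_eqF // hyp_gt0 // ltW.
move=> n h x h0 x0.
apply: (@nonneg_euler_ode _ (s - 3 / 2) (fun t => iter n (diff h) (q t) x)
  (fun t => iter n (diff h) (q' t) x)); last by rewrite ler01 lexx.
- by rewrite subr_gt0.
- by move=> t _; apply: is_derive_iter_diff.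
move=> t /andP[t0 t1]; rewrite -!iter_diffZ -iter_diffD.
have t2 : 0 <= t * t <= 1 by rewrite mulr_ge0 // mulr_ile1.
rewrite (@eq_iter_diff _ _ _ _ (fun x => (s - 3 / 2) * (s - 2^-1) *
    (expR (- ((1 - t) * Num.sqrt x)) * (hyp s (t * t * x) / hyp s x)))) //; last first.
  by move=> y xy; apply: q_ode; apply: lt_le_trans xy.
rewrite iter_diffZ mulr_ge0 //.
  by rewrite mulr_ge0 // subr_ge0; move: s32; lra.
apply: cmonoM => //; last exact: cmono_hyp_ratio.
by apply: cmono_expRN; apply: bernsteinZ; [rewrite subr_ge0|exact: bernstein_sqrt].
Qed.

(** The derivative in the scale [t] is [1 / t] times the Bernstein function of
    [bernstein_sqrt_sub_logderiv] taken at [t * t * x]. *)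
Lemma bernstein_sqrt_sub_ln_hyp a b : 0 < a -> a <= b ->
  bernstein (fun x => (b * Num.sqrt x - ln (hyp s (b * b * x)))
     - (a * Num.sqrt x - ln (hyp s (a * a * x)))).
Proof.
move=> a0 ab.
apply: (@bernstein_increment _ a b (fun t x => t * Num.sqrt x - ln (hyp s (t * t * x)))
  (fun t x => t^-1 * (Num.sqrt (t * t * x) -
      2 * (t * t * x * hyp' s (t * t * x) / hyp s (t * t * x))))) => //.
  move=> t x /andP[at_ _] x0; have t0 : 0 < t := lt_le_trans a0 at_.
  have h0 : 0 < hyp s (t * t * x) by rewrite hyp_gt0 // !mulr_ge0 // ltW.
  apply: (@is_derive_eq _ _ _ _ _ _ _ _ (is_derive1B
    (is_derive1M (is_derive_id t 1) (is_derive_cst (Num.sqrt x) t 1))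
    (@is_derive1_compE _ _ (fun t => hyp s (t * t * x)) _ _ _ (is_derive1_ln h0) (dhyp t x)))).
  rewrite sqrtrM ?mulr_ge0 ?ltW // -expr2 sqrtr_sqr gtr0_norm //=.
  by field; rewrite !gt_eqF.
move=> t /andP[at_ _]; have t0 : 0 < t := lt_le_trans a0 at_.
apply: bernsteinZ; first by rewrite invr_ge0 ltW.
exact: (bernstein_scale (mulr_gt0 t0 t0) bernstein_sqrt_sub_logderiv).
Qed.

End LargeOrder.

End BesselExponents.

(** * Splitting off an exponential law; Bessel functions as series *)

Section ExponentialFactor.
Variable R : realType.
Implicit Types (x a p : R).

Lemma bernoulli_exprD a x m : 0 <= a -> 0 <= x ->
  x ^+ m.+1 + m.+1%:R * a * x ^+ m <= (a + x) ^+ m.+1.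
Proof.
move=> a0 x0; elim: m => [|m IH]; first by rewrite !expr1 expr0 mulr1 mul1r addrC.
rewrite [leRHS]exprS; apply: le_trans (_ : (a + x) * (x ^+ m.+1 + m.+1%:R * a * x ^+ m) <= _); last first.
  by rewrite ler_wpM2l // addr_ge0.
rewrite -subr_ge0 (_ : _ - _ = m.+1%:R * a ^+ 2 * x ^+ m); last first.
  by rewrite -[m.+2%:R]natr1 !exprS; ring.
by rewrite !mulr_ge0 ?exprn_ge0.
Qed.

(** A Wallis-type estimate; the induction step rests on (n + 3/2)^2 exceeding (n + 1)(n + 2) by
    1/4. *)
Lemma fact_sqr_le_pochhammer_half k :
  k`!%:R ^+ 2 <= 4 * k.+1%:R * pochhammer (2^-1 : R) k ^+ 2.
Proof.
suff H n : n.+1`!%:R ^+ 2 <= 4 * n.+1%:R * pochhammer (2^-1 : R) n.+1 ^+ 2.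
  case: k => [|k]; first by rewrite /pochhammer big_ord0 fact0 !expr1n; lra.
  apply: le_trans (H k) _; apply: ler_wpM2r; last by rewrite ler_wpM2l // ler_nat.
  by rewrite exprn_ge0 // ltW // pochhammer_gt0 // invr_gt0.
elim: n => [|n IH].
  by rewrite pochhammerS /pochhammer big_ord0 addr0 factS fact0; lra.
rewrite factS natrM exprMn pochhammerS exprMn.
apply: le_trans (_ : n.+2%:R ^+ 2 * (4 * n.+1%:R * pochhammer 2^-1 n.+1 ^+ 2) <= _).
  by rewrite ler_wpM2l // exprn_ge0.
rewrite -subr_ge0.
have -> : 4 * n.+2%:R * (pochhammer (2^-1 : R) n.+1 ^+ 2 * (2^-1 + n.+1%:R) ^+ 2) -
    n.+2%:R ^+ 2 * (4 * n.+1%:R * pochhammer 2^-1 n.+1 ^+ 2) =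
    n.+2%:R * pochhammer 2^-1 n.+1 ^+ 2.
  by rewrite -[n.+2%:R]natr1; field.
by rewrite mulr_ge0 // exprn_ge0 // ltW // pochhammer_gt0 // invr_gt0.
Qed.

Lemma is_derive_pochhammer_powR p c k x : 0 < c + x ->
  is_derive x (1 : R) (fun x => pochhammer p k * (c + x) `^ (- p - k%:R))
    (- (pochhammer p k.+1 * (c + x) `^ (- p - k.+1%:R))).
Proof.
move=> cx0; have dc : is_derive x (1 : R) (fun x : R => c + x) 1.
  apply: (@is_derive_eq _ _ _ _ _ _ _ _ (is_derive1D (is_derive_cst c x 1) (is_derive_id x 1))).
  by rewrite add0r.
apply: (@is_derive_eq _ _ _ _ _ _ _ _ (is_derive1Z _
  (@is_derive1_compE _ _ (fun x => c + x) _ _ _ (is_derive1_powR (- p - k%:R) cx0) dc))).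
rewrite pochhammerS -[k.+1%:R]natr1.
have -> : - p - (k%:R + 1) = - p - k%:R - 1 by ring.
ring.
Qed.

(* [exp(-a sqrt x)] is the transform of an exponential law times a completely
   monotone factor: this is where the full support comes from. *)
Lemma bernstein_sqrt_sub_ln a : 0 < a ->
  bernstein (fun x => a * Num.sqrt x - ln (1 + a ^+ 2 / 8 * x)).
Proof.
(* The value for which [(a / 2) ^ 2 * (2 k + 2) * al] equals the constant [4 (k + 1)] of
   [fact_sqr_le_pochhammer_half]. *)
move=> a0; pose al := 8 / a ^+ 2.
have al0 : 0 < al by rewrite divr_gt0 // exprn_gt0.
(* Up to the sign (-1)^k, the k-th derivative of [a / (2 sqrt x) - 1 / (al + x)]. *)
pose f k x : R := a / 2 * (pochhammer 2^-1 k * (0 + x) `^ (- 2^-1 - k%:R)) -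
   pochhammer 1 k * (al + x) `^ (- 1 - k%:R).
apply: (@bernstein_derive _ _ (f 0%N)).
  move=> x x0; have l0 : 0 < 1 + a ^+ 2 / 8 * x.
    by rewrite addr_gt0 // mulr_gt0 // divr_gt0 // exprn_gt0.
  have dc : is_derive x (1 : R) (fun x : R => 1 + a ^+ 2 / 8 * x) (a ^+ 2 / 8).
    apply: (@is_derive_eq _ _ _ _ _ _ _ _ (is_derive1D (is_derive_cst (1 : R) x 1)
      (is_derive1Z (a ^+ 2 / 8) (is_derive_id x 1)))).
    by rewrite add0r mulr1.
  apply: (@is_derive_eq _ _ _ _ _ _ _ _ (is_derive1B (is_derive1Z a (is_derive1_sqrt x0))
    (@is_derive1_compE _ _ (fun x => 1 + a ^+ 2 / 8 * x) _ _ _ (is_derive1_ln l0) dc))).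
  rewrite /f /pochhammer !big_ord0 !subr0 add0r !mul1r sqrt_derivE //.
  rewrite powR_inv1 ?addr_ge0 ?ltW // mulrA; congr (_ - _); first by field.
  rewrite /al; field.
  by rewrite !gt_eqF ?addr_gt0 // ?mulr_gt0 ?exprn_gt0 //.
apply: cmono_derive => k x x0; last first.
  apply: (@is_derive_eq _ _ _ _ _ _ _ _ (is_derive1B
    (is_derive1Z (a / 2) (@is_derive_pochhammer_powR 2^-1 0 k x _))
    (@is_derive_pochhammer_powR 1 al k x _))); rewrite ?add0r ?addr_gt0 //.
  by rewrite /f add0r; ring.
rewrite /f add0r subr_ge0.
have p0 : 0 < pochhammer (2^-1 : R) k by rewrite pochhammer_gt0 // invr_gt0.
have -> : pochhammer 1 k = k`!%:R :> R.
  elim: k {p0} => [|k IH]; first by rewrite /pochhammer big_ord0 fact0.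
  by rewrite pochhammerS IH factS natrM nat1r mulrC.
have alx0 : 0 < al + x by rewrite addr_gt0.
(* Squaring clears the half-integer powers. It remains to combine [fact_sqr_le_pochhammer_half] with
   the lower bound [(2 k + 2) al x ^ (2 k + 1)] for [(al + x) ^ (2 k + 2)]. *)
rewrite -ler_sqr ?nnegrE; last 2 first.
- by rewrite mulr_ge0 ?powR_ge0.
- by rewrite !mulr_ge0 ?powR_ge0 ?invr_ge0 // ltW.
have powR2 y (p : R) m : 0 < y -> p *+ 2 = - m%:R -> (y `^ p) ^+ 2 = y ^- m.
  move=> y0 pm; rewrite -powR_mulrn ?powR_ge0 // -powRrM mulr_natr pm powRN powR_mulrn //.
  exact: ltW.
rewrite [leLHS]exprMn [leRHS]exprMn [(pochhammer _ _ * _) ^+ 2]exprMn (powR2 x _ k.*2.+1) //; last first.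
  by rewrite -[k.*2.+1%:R]natr1 -muln2 natrM; field.
rewrite (powR2 (al + x) _ k.*2.+2) //; last first.
  by rewrite -[k.*2.+2%:R]natr1 -[k.*2.+1%:R]natr1 -muln2 natrM; ring.
rewrite mulrA ler_pdivrMr ?exprn_gt0 // [leRHS]mulrAC ler_pdivlMr ?exprn_gt0 //.
apply: le_trans (_ : (4 * k.+1%:R * pochhammer (2^-1 : R) k ^+ 2) * x ^+ k.*2.+1 <= _).
  by rewrite ler_wpM2r ?exprn_ge0 ?(ltW x0) // fact_sqr_le_pochhammer_half.
have H := bernoulli_exprD k.*2.+1 (ltW al0) (ltW x0).
have {}H : k.*2.+2%:R * al * x ^+ k.*2.+1 <= (al + x) ^+ k.*2.+2.
  by apply: le_trans H; rewrite lerDr exprn_ge0 // ltW.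
apply: le_trans (_ : (a / 2) ^+ 2 * pochhammer (2^-1 : R) k ^+ 2 * (k.*2.+2%:R * al * x ^+ k.*2.+1) <= _); last first.
  by rewrite ler_wpM2l // mulr_ge0 // exprn_ge0 // ?divr_ge0 // ltW.
rewrite le_eqVlt; apply/orP; left; apply/eqP.
have -> : k.*2.+2%:R = 2 * k.+1%:R :> R by rewrite -doubleS -mul2n natrM.
by rewrite /al; field; rewrite gt_eqF.
Qed.

Lemma besselIE m x : -1 < m -> 0 < x ->
  besselI m x = (x / 2) `^ m / Gamma (m + 1) * hyp (m + 1) (x ^+ 2).
Proof.
move=> m1 x0; have s0 : 0 < m + 1 by rewrite -ltrBlDr sub0r.
have x20 : 0 < x / 2 by rewrite divr_gt0.
rewrite /besselI (_ : series _ =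
   (fun n => (x / 2) `^ m / Gamma (m + 1) * pseries (hyp_coef (m + 1)) (x ^+ 2) n)).
  by apply: cvg_lim => //; apply: cvgM; [exact: cvg_cst|exact: is_cvg_hyp].
apply/funext => n; rewrite /pseries /series /= mulr_sumr; apply: eq_bigr => k _.
rewrite -addrA Gamma_pochhammer // powRD; last by apply/implyP => _; rewrite gt_eqF.
rewrite -natrM powR_mulrn ?ltW // /hyp_coef.
have p0 := pochhammer_gt0 k s0; have G0 := Gamma_gt0 s0.
rewrite exprM expr_div_n exprMn exprVn (_ : 2 ^+ 2 = 4 :> R); last by rewrite -natrX.
field.
by rewrite !gt_eqF // ?exprn_gt0 // ltr0n fact_gt0.
Qed.

End ExponentialFactor.

(** * The law *)

Section Assembly.
Variable R : realType.
Implicit Types (s x : R).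

(** [hyp_le_expR] asks for [s >= 1], so [hyp_contiguous] first raises the parameter to [s + 1] and
    [s + 2]; the resulting factor [1 + k x ^ 2] is absorbed by [expR (2 (k + 1) x)]. *)
Lemma hyp_le_expR_linear s : 0 < s ->
  exists C : R, forall x, 0 <= x -> ln (hyp s (x ^+ 2)) <= C * x.
Proof.
move=> s0; have s1 : 1 <= s + 1 by rewrite lerDr ltW.
have s2 : 1 <= s + 1 + 1 by rewrite (le_trans s1) // lerDl.
pose k := (4 * s * (s + 1))^-1.
have k0 : 0 <= k by rewrite invr_ge0 ltW // !mulr_gt0 // addr_gt0.
exists (1 + 2 * (k + 1)) => x x0.
have e0 := expR_gt0 x.
rewrite -[leRHS]expRK ler_ln ?posrE ?expR_gt0 ?hyp_gt0 ?sqr_ge0 //.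
rewrite hyp_contiguous // -/k.
apply: (@le_trans _ _ (expR x * (1 + k * x ^+ 2))).
  rewrite mulrDr mulr1 lerD ?hyp_le_expR // mulrC ler_wpM2r ?mulr_ge0 ?sqr_ge0 //.
  exact: hyp_le_expR.
rewrite mulrDl mul1r expRD ler_pM2l //.
apply: (@le_trans _ _ ((1 + (k + 1) * x) ^+ 2)).
  rewrite -subr_ge0 (_ : _ - _ = 2 * (k + 1) * x + (k ^+ 2 + k + 1) * x ^+ 2); last by ring.
  apply: addr_ge0; first by rewrite !mulr_ge0 // addr_ge0.
  by rewrite mulr_ge0 ?sqr_ge0 // !addr_ge0 ?sqr_ge0.
rewrite -mulrA expRM_natl lerXn2r ?nnegrE ?addr_ge0 ?mulr_ge0 ?expR_ge0 ?addr_ge0 //.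
exact: expR_ge1Dx.
Qed.

(** Without mass on [0, e[ the transform would be at most [expR (- (x * e))], forcing
    [x * e <= C * sqrt x]; this fails at [sqrt x = |C| / e + 1]. *)
Lemma halfline_mass_near0 (P : probability (measurableTypeR R) R) (psi : R -> R) (C e : R) :
  on_halfline P -> (forall x, 0 < x -> laplace P x = expR (- psi x)) ->
  (forall x, 0 < x -> psi x <= C * Num.sqrt x) -> 0 < e ->
  (0 < P `[0%R, e[%classic)%E.
Proof.
move=> P0 LP psiC e0; rewrite lt0e measure_ge0 andbT; apply/eqP => Pe.
have mexp x : measurable_fun (`[0, +oo[%classic : set (measurableTypeR R)) (fun t : measurableTypeR R => (expR (- (x * t)))%:E).
  apply/measurable_EFinP; apply: measurable_funTS; apply: continuous_measurable_fun => t.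
  have cM : {for t, continuous (fun t : R => - (x * t))}.
    by apply: cvgN; apply: cvgM; [exact: cvg_cst|exact: cvg_id].
  exact: (continuous_comp cM (@continuous_expR R _)).
have m0y : measurable (`[0, +oo[%classic : set (measurableTypeR R)) by exact: measurable_itv.
have m0e : measurable (`[0, e[%classic : set (measurableTypeR R)) by exact: measurable_itv.
have bound x : 0 < x -> laplace P x <= expR (- (x * e)).
  move=> x0.
  have I : (\int[P]_(t in `[0%R, +oo[) (expR (- (x * t)))%:E <= (expR (- (x * e)))%:E)%E.
    rewrite (@ge0_negligible_integral _ _ _ P _ `[0, e[%classic) //.
    apply: (@le_trans _ _ (\int[P]_(t in `[0%R, +oo[ `\` `[0%R, e[) (cst (expR (- (x * e)))%:E t))%E).
      apply: ge0_le_integral => //.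
      - exact: measurableD.
      - by apply: measurable_funS (mexp x) => //; exact: subDsetl.
      move=> t [] /=; rewrite !in_itv /= andbT => t0; rewrite t0 /= => /negP; rewrite -leNgt => et.
      by rewrite lee_fin ler_expR lerN2 ler_pM2l.
    rewrite integral_cst; last exact: measurableD.
    rewrite -[leRHS]mule1 lee_wpmul2l ?lee_fin ?expR_ge0 //.
    exact: probability_le1 (measurableD m0y m0e).
  rewrite /laplace /Rintegral -lee_fin fineK // ge0_fin_numE ?(le_lt_trans I) ?ltry //.
  by apply: integral_ge0 => t _; rewrite lee_fin expR_ge0.
pose r := `|C| / e + 1.
have r0 : 0 < r by rewrite ltr_wpDl // divr_ge0 // ltW.
have := bound (r ^+ 2) (exprn_gt0 _ r0).
rewrite LP ?exprn_gt0 // ler_expR lerN2 => H.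
have := le_trans H (psiC _ (exprn_gt0 2 r0)).
rewrite sqrtr_sqr gtr0_norm // expr2 mulrAC ler_pM2r //.
rewrite leNgt => /negP; apply; rewrite /r mulrDl divfK ?gt_eqF // mul1r.
by rewrite (le_lt_trans (ler_norm C)) // ltrDl.
Qed.

Section Exponents.
Variables (m n a b : R).
Hypotheses (hm : -1 < m) (hn : 1 / 2 < n) (ha : 0 < a) (hab : a < b).

Let m0 : 0 < m + 1. Proof. by rewrite -ltrBlDr sub0r. Qed.
Let n32 : 3 / 2 < n + 1. Proof. by move: hn; lra. Qed.
Let n0 : 0 < n + 1. Proof. by move: hn; lra. Qed.
Let b0 : 0 < b. Proof. exact: lt_trans hab. Qed.

Definition ratio_exponent x : R :=
  (ln (hyp (m + 1) (b * b * x)) - ln (hyp (m + 1) (a * a * x))) +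
  ((b * Num.sqrt x - ln (hyp (n + 1) (b * b * x))) -
   (a * Num.sqrt x - ln (hyp (n + 1) (a * a * x)))).

Lemma bernstein_ratio_exponent : bernstein ratio_exponent.
Proof.
apply: bernsteinD; last by apply: bernstein_sqrt_sub_ln_hyp => //; exact: ltW.
apply: bernstein_ln_hyp_ratio => //; first exact: mulr_gt0.
by rewrite ler_pM ?ltW.
Qed.

(** By [besselIE] the Gamma constants cancel, and the powers of [a] and [b] cancel against the
    prefactor [(b / a) ^ (m - n)]; a quotient of [hyp] values remains. *)
Lemma OmegaE x : 0 < x -> Omega m n a b x = expR (- (ratio_exponent x + a * Num.sqrt x)).
Proof.
move=> x0; have s0 : 0 < Num.sqrt x by rewrite sqrtr_gt0.
have s20 : 0 < Num.sqrt x / 2 by rewrite divr_gt0.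
have n1 : -1 < n by move: hn; lra.
have hyp_pos k c : 0 < k -> 0 < c -> 0 < hyp k (c * c * x).
  by move=> k0 c0; rewrite hyp_gt0 // !mulr_ge0 // ltW.
have sq c : (c * Num.sqrt x) ^+ 2 = c * c * x.
  by rewrite exprMn sqr_sqrtr ?ltW // expr2.
rewrite /Omega !besselIE ?mulr_gt0 // !sq.
have -> : expR (- (ratio_exponent x + a * Num.sqrt x)) =
    hyp (m + 1) (a * a * x) * hyp (n + 1) (b * b * x) /
    (hyp (m + 1) (b * b * x) * hyp (n + 1) (a * a * x)) * expR (- (b * Num.sqrt x)).
  rewrite (_ : - _ = ln (hyp (m + 1) (a * a * x)) + ln (hyp (n + 1) (b * b * x))
    - ln (hyp (m + 1) (b * b * x)) - ln (hyp (n + 1) (a * a * x)) - b * Num.sqrt x); last first.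
    by rewrite /ratio_exponent; ring.
  rewrite !expRD !expRN !lnK ?posrE ?hyp_pos //.
  by rewrite invfM; ring.
congr (_ * _).
have pw c p : 0 < c -> (c * Num.sqrt x / 2) `^ p = c `^ p * (Num.sqrt x / 2) `^ p.
  by move=> c0; rewrite -mulrA powRM // ltW.
rewrite !pw // powRB; last by apply/implyP => _; rewrite gt_eqF // divr_gt0.
have pd p : (b / a) `^ p = b `^ p / a `^ p.
  by rewrite powRM ?invr_ge0 ?ltW // -powR_inv1 ?ltW // -powRrM mulN1r powRN.
rewrite !pd; field.
by rewrite !gt_eqF ?powR_gt0 ?hyp_pos ?Gamma_gt0.
Qed.

Let continuous_ln_hyp s c x : 0 < s -> 0 <= c -> 0 <= x ->
  {for x, continuous (fun x => ln (hyp s (c * x)))}.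
Proof.
move=> s0 c0 x0; have cM : {for x, continuous (fun x : R => c * x)}.
  by apply: cvgM; [exact: cvg_cst|exact: cvg_id].
have ch : {for x, continuous (fun x : R => hyp s (c * x))}.
  exact: continuous_comp cM (@continuous_hyp _ _ s0 _).
have cl : {for hyp s (c * x), continuous (@ln R)}.
  by apply: continuous_ln; rewrite hyp_gt0 // mulr_ge0.
exact: (continuous_comp ch cl).
Qed.

Let continuous_Zsqrt c x : {for x, continuous (fun x => c * Num.sqrt x)}.
Proof. by apply: cvgM; [exact: cvg_cst|exact: sqrt_continuous]. Qed.

Lemma continuous_ratio_exponent x : 0 <= x -> {for x, continuous ratio_exponent}.
Proof.
move=> x0; have a2 : 0 <= a * a by rewrite mulr_ge0 // ltW.
have b2 : 0 <= b * b by rewrite mulr_ge0 // ltW.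
have cl k c := @continuous_ln_hyp k c x.
exact: (continuousD (continuousB (cl _ _ m0 b2 x0) (cl _ _ m0 a2 x0))
  (continuousB (continuousB (@continuous_Zsqrt b x) (cl _ _ n0 b2 x0))
    (continuousB (@continuous_Zsqrt a x) (cl _ _ n0 a2 x0)))).
Qed.

Lemma ratio_exponent0 : ratio_exponent 0 = 0.
Proof. by rewrite /ratio_exponent !mulr0 !hyp0 ln1 sqrtr0 !mulr0; ring. Qed.

(** The two subtracted logarithms are nonnegative because [hyp] is at least 1 there; the other two
    grow at most like [sqrt x]. *)
Lemma ratio_exponent_le : exists C : R, forall x, 0 < x -> ratio_exponent x <= C * Num.sqrt x.
Proof.
have [C1 H1] := hyp_le_expR_linear m0; have [C2 H2] := hyp_le_expR_linear n0.
exists (C1 * b + b - a + C2 * a) => x x0.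
have sq c : (c * Num.sqrt x) ^+ 2 = c * c * x.
  by rewrite exprMn sqr_sqrtr ?ltW // expr2.
have := H1 (b * Num.sqrt x); rewrite sq mulr_ge0 ?(ltW b0) // => /(_ isT) {}H1.
have := H2 (a * Num.sqrt x); rewrite sq mulr_ge0 ?(ltW ha) // => /(_ isT) {}H2.
have ln_hyp_ge0 k c : 0 < k -> 0 < c -> 0 <= ln (hyp k (c * c * x)).
  by move=> k0 c0; rewrite ln_ge0 // hyp_ge1 // !mulr_ge0 // ltW.
have := ln_hyp_ge0 _ _ m0 ha; have := ln_hyp_ge0 _ _ n0 b0.
rewrite /ratio_exponent; move: H1 H2; lra.
Qed.

Lemma exponent_law (psi : R -> R) : bernstein psi ->
  (forall x, 0 <= x -> {for x, continuous psi}) -> psi 0 = 0 ->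
  exists2 P : probability (measurableTypeR R) R, on_halfline P &
    forall x, 0 < x -> laplace P x = expR (- psi x).
Proof.
move=> bpsi cpsi psi0.
have cE x : 0 <= x -> {for x, continuous (fun x => expR (- psi x))}.
  move=> x0; apply: (@continuous_comp _ _ _ (fun x => - psi x) expR); last exact: continuous_expR.
  by apply: cvgN; exact: cpsi.
apply: bernstein_theorem; first exact: cmono_expRN.
  by move=> x x0; apply: cE; exact: ltW.
have := cvg_at_right_filter (cE 0 (lexx 0)).
by rewrite psi0 oppr0 expR0.
Qed.

End Exponents.

End Assembly.

Unset Implicit Arguments.

Theorem theorem9 (R : realType) (mu nu a b : R)
    (hmu : -1 < mu) (hnu : 1 / 2 < nu) (ha : 0 < a) (hab : a < b) :
  exists lam : probability (measurableTypeR R) R,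
    [/\ infinitely_divisible lam,
        msupport lam = `[0, +oo[%classic &
        forall x : R, 0 < x -> laplace lam x = Omega mu nu a b x].
Proof.
pose psi x := ratio_exponent mu nu a b x.
have bpsi : bernstein psi by exact: bernstein_ratio_exponent.
have cpsi x : 0 <= x -> {for x, continuous psi} by exact: continuous_ratio_exponent.
have csq x : {for x, continuous (fun x => a * Num.sqrt x)}.
  by apply: cvgM; [exact: cvg_cst|exact: sqrt_continuous].
(* [expR (- chi x)] is [Omega] times [1 + a ^ 2 x / 8]: what is left after dividing out the
   transform of an exponential law. *)
pose chi x := psi x + (a * Num.sqrt x - ln (1 + a ^+ 2 / 8 * x)).
have lin0 x : 0 <= x -> 0 < 1 + a ^+ 2 / 8 * x.
  by move=> x0; rewrite ltr_wpDr // mulr_ge0 // divr_ge0 // sqr_ge0.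
have [P P0 LP] : exists2 P : probability (measurableTypeR R) R, on_halfline P &
    forall x, 0 < x -> laplace P x = expR (- chi x).
  apply: exponent_law.
  - by apply: bernsteinD => //; exact: bernstein_sqrt_sub_ln.
  - move=> x x0.
    have cl : {for x, continuous (fun x : R => 1 + a ^+ 2 / 8 * x)}.
      by apply: cvgD; [exact: cvg_cst|apply: cvgM; [exact: cvg_cst|exact: cvg_id]].
    exact: (continuousD (cpsi x x0) (continuousB (csq x)
      (continuous_comp cl (continuous_ln (lin0 x x0))))).
  - by rewrite /chi /psi ratio_exponent0 sqrtr0 !mulr0 addr0 ln1 subrr addr0.
(* The rate for which [1 + x / c] is [1 + a ^ 2 x / 8]. *)
pose c := 8 / a ^+ 2.
have c0 : 0 < c by rewrite divr_gt0 // exprn_gt0.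
pose lam := exponential_convolution c P.
have lam0 : on_halfline lam by exact: on_halfline_exponential_convolution.
have Llam x : 0 < x -> laplace lam x = Omega mu nu a b x.
  move=> x0; rewrite laplace_exponential_convolution // LP // OmegaE //.
  have -> : x / c = a ^+ 2 / 8 * x by rewrite /c; field; rewrite gt_eqF.
  rewrite /chi -/(psi x) addrA opprB expRD lnK ?posrE ?lin0 ?ltW //.
  by rewrite mulrAC divff ?mul1r // gt_eqF // lin0 // ltW.
exists lam; split => //.
- split=> // k k0.
  (* The k-th root divides the exponent by [k], which keeps it Bernstein. *)
  have [Q Q0 LQ] : exists2 Q : probability (measurableTypeR R) R, on_halfline Q &
      forall x, 0 < x -> laplace Q x = expR (- (k%:R^-1 * (psi x + a * Num.sqrt x))).
    apply: exponent_law.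
    + apply: bernsteinZ; first by rewrite invr_ge0.
      by apply: bernsteinD => //; apply: bernsteinZ; [exact: ltW|exact: bernstein_sqrt].
    + move=> x x0; have cs := continuousD (cpsi x x0) (csq x).
      by apply: cvgM; [exact: cvg_cst|exact: cs].
    + by rewrite /psi ratio_exponent0 sqrtr0 !mulr0 addr0 mulr0.
  exists Q => // x x0; rewrite Llam // LQ // OmegaE // -expRM_natl; congr expR.
  by rewrite mulrN mulrA divff ?mul1r // pnatr_eq0 -lt0n.
- have [C psiC] := ratio_exponent_le hmu hnu ha hab.
  have chiC x : 0 < x -> chi x <= (C + a) * Num.sqrt x.
    move=> x0; rewrite mulrDl lerD ?psiC // gerBl ln_ge0 // lerDl.
    by rewrite mulr_ge0 ?ltW // divr_gt0 // exprn_gt0.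
  apply/seteqP; split => t /=.
    move=> supp; rewrite in_itv /= andbT leNgt; apply/negP => t0.
    have : (0 < lam `]-oo, 0%R[%classic)%E.
      by apply: supp; [exact: interval_open|rewrite /= in_itv].
    rewrite -setCitvr probability_setC; last exact: measurable_itv.
    by rewrite lam0 subee // ltxx.
  rewrite in_itv /= andbT => t0 V oV Vt.
  have [e /= e0 eV] : nbhs t V by exact: open_nbhs_nbhs.
  (* Half of the radius goes to the law [P] near 0 and half to the exponential law near [t]; the sum
     then falls in [t, t + e[. *)
  have e20 : 0 < e / 2 by rewrite divr_gt0.
  have Pe := halfline_mass_near0 P0 LP chiC e20.
  apply: (lt_le_trans (exponential_convolution_gt0 c0 t0 e20 Pe)).
  apply: le_measure; rewrite ?inE; [exact: measurable_itv|exact: open_measurable|].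
  move=> s /=; rewrite in_itv /= => /andP[ts st]; apply: eV => /=.
  by rewrite distrC ger0_norm ?subr_ge0 // ltrBlDl (lt_le_trans st) // -splitr.
Qed.
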